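(* Let $k$ be a field, let $R=k[x_1,\ldots,x_n]$ with its standard $\mathbb{Z}^n$-grading, let $I\subseteq R$ be a nonzero monomial ideal, let $B$ be the Betti poset of $I$ over $k$, and let $\eta\colon B\to\mathbb{Z}^n$ be the inclusion. Then $I$ is Betti-linear if and only if the poset construction on $B$ recovers the minimal free resolution of $I$, i.e. if and only if the homogenized sequence $\mathscr{F}(\eta)$ of $\mathbb{Z}^n$-graded free $R$-modules and $R$-linear maps obtained from the poset construction $\mathscr{D}(B,k)$ is isomorphic (as a sequence of $\mathbb{Z}^n$-graded modules and degree-preserving maps) to the minimal $\mathbb{Z}^n$-graded free resolution of $I$. In particular, if $I$ has pure resolution, then $\mathscr{F}(\eta)$ is a minimal $\mathbb{Z}^n$-graded free resolution of $I$.
   Context: **Resolution and Betti poset.** Let $\mathcal{F}\colon 0\leftarrow F_0\xleftarrow{\phi_1}F_1\leftarrow\cdots\leftarrow F_m\leftarrow 0$ be the minimal $\mathbb{Z}^n$-graded free resolution of $I$ over $R$ (so $F_0$ has one basis element for each minimal monomial generator of $I$). A monomial $x^a$ is identified with its exponent $a\in\mathbb{Z}^n$. $R(-\gamma)$ is the free $R$-module with one basis element, of degree $\gamma$. The *Betti poset* $B$ of $I$ over $k$ is the set of $\mathbb{Z}^n$-degrees of homogeneous basis elements of the modules $F_i$ (all $i$), ordered by divisibility (componentwise order in $\mathbb{Z}^n$). In a poset, $y\lessdot x$ (written $y\lessdot_B x$ for the poset $B$) means that $x$ covers $y$: $y<x$ and there is no $z$ with $y<z<x$. **Betti-linear.**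 $I$ is *Betti-linear* if one can choose $\mathbb{Z}^n$-homogeneous bases $B_t$ of $F_t$ for all $t$ so that for all $i\ge1$ and all $\tau\in B_i$, writing $\phi_i(\tau)=\sum_{\gamma\in B_{i-1}}[\tau:\gamma]\,\gamma$ with $[\tau:\gamma]\in R$, one has: $[\tau:\gamma]\ne0$ implies $\mathrm{mdeg}(\gamma)\lessdot_B\mathrm{mdeg}(\tau)$, where $\mathrm{mdeg}$ is the $\mathbb{Z}^n$-degree. **Pure resolution.** $I$ has *pure resolution* if for each $i$ there is an integer $d_i$ such that all homogeneous basis elements of $F_i$ have total degree $d_i$. **Poset construction.** For a finite poset $P$, $\Delta(P)$ is its order complex (faces are the finite chains of $P$; for the empty poset it is the complex $\{\emptyset\}$, with $\widetilde H_{-1}(\{\emptyset\},k)=k$). For $\alpha\in P$ put $\Delta_\alpha=\Delta(P_{<\alpha})$ and $\Delta_{\le\alpha}=\Delta(P_{\le\alpha})$, so $\Delta_\alpha=\bigcup_{\lambda\lessdot\alpha}\Delta_{\le\lambda}$; for $\lambda\lessdot\alpha$ put $$\Delta_{\alpha,\lambda}=\Delta_{\le\lambda}\cap\Bigl(\bigcup_{\lambda\ne\beta\lessdot\alpha}\Delta_{\le\beta}\Bigr)\subseteq\Delta_\lambda ,$$ where an empty union means $\{\emptyset\}$. For $i\ge0$ set $\mathscr{D}_{i,\alpha}=\widetilde H_{i-1}(\Delta_\alpha,k)$ and $\mathscr{D}_i=\bigoplus_{\alpha\in P}\mathscr{D}_{i,\alpha}$. For $i\ge1$ and $\lambda\lessdot\alpha$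 let $\partial^{\alpha,\lambda}_{i-1}\colon\widetilde H_{i-1}(\Delta_\alpha,k)\to\widetilde H_{i-2}(\Delta_{\alpha,\lambda},k)$ be the connecting homomorphism of the reduced Mayer–Vietoris sequence of $\Delta_\alpha=\Delta_{\le\lambda}\cup\bigcup_{\lambda\ne\beta\lessdot\alpha}\Delta_{\le\beta}$: if a cycle $c$ is written $c=c'+c''$ with $c'$ supported on $\Delta_{\le\lambda}$ and $c''$ supported on $\bigcup_{\lambda\ne\beta\lessdot\alpha}\Delta_{\le\beta}$, then $[c]\mapsto[d(c')]$, $d$ the simplicial boundary. Let $\phi^{\alpha,\lambda}_i\colon\mathscr{D}_{i,\alpha}\to\mathscr{D}_{i-1,\lambda}$ be the composition of $\partial^{\alpha,\lambda}_{i-1}$ with the map $\widetilde H_{i-2}(\Delta_{\alpha,\lambda},k)\to\widetilde H_{i-2}(\Delta_\lambda,k)$ induced by inclusion, and define $\phi_i\colon\mathscr{D}_i\to\mathscr{D}_{i-1}$ by $\phi_i|_{\mathscr{D}_{i,\alpha}}=\sum_{\lambda\lessdot\alpha}\phi^{\alpha,\lambda}_i$. The sequence $\mathscr{D}(P,k)\colon\mathscr{D}_0\xleftarrow{\phi_1}\mathscr{D}_1\leftarrow\cdots$ is the *poset construction* on $P$ over $k$; it is not assumed to be a complex. **Homogenization.** Given an order-preserving map $\eta\colon P\to\mathbb{Z}^n$, set $\mathscr{F}_i(\eta)=\bigoplus_{\lambda\in P}\mathscr{D}_{i,\lambda}\otimes_kR(-\eta(\lambda))$, with $\mathscr{F}_{i,\alpha}(\eta)=\mathscr{D}_{i,\alpha}\otimes_kR(-\eta(\alpha))$,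 and $\partial_i\colon\mathscr{F}_i(\eta)\to\mathscr{F}_{i-1}(\eta)$ by $\partial_i|_{\mathscr{F}_{i,\alpha}(\eta)}=\sum_{\lambda\lessdot\alpha}x^{\eta(\alpha)-\eta(\lambda)}\otimes\phi^{\alpha,\lambda}_i$. The resulting sequence is $\mathscr{F}(\eta)$. *)

(* Defs.v *)
From HB Require Import structures.
From mathcomp Require Import all_boot all_order all_algebra.
From mathcomp Require Import mpoly.

Set Implicit Arguments.
Unset Strict Implicit.
Unset Printing Implicit Defensive.

Import Order.TTheory GRing.Theory Num.Theory.
Local Open Scope ring_scope.

Definition zdeg (n : nat) := {ffun 'I_n -> int}.
HB.instance Definition _ n := GRing.Zmodule.on (zdeg n).

Fact zdeg_display : Order.disp_t. Proof. exact: Order.Disp tt tt. Qed.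

Definition zdeg_le n (a b : zdeg n) := [forall j, a j <= b j].

Fact zdeg_le_refl n : reflexive (@zdeg_le n).
Proof. by move=> a; apply/forallP. Qed.

Fact zdeg_le_anti n : antisymmetric (@zdeg_le n).
Proof.
move=> a b /andP[/forallP ab /forallP ba]; apply/ffunP => j.
by apply/le_anti; rewrite ab ba.
Qed.

Fact zdeg_le_trans n : transitive (@zdeg_le n).
Proof.
move=> b a c /forallP ab /forallP bc; apply/forallP => j.
exact: le_trans (ab j) (bc j).
Qed.

HB.instance Definition _ n := Order.Le_isPOrder.Build zdeg_display (zdeg n)
  (@zdeg_le_refl n) (@zdeg_le_anti n) (@zdeg_le_trans n).

Definition total_deg n (a : zdeg n) : int := \sum_j a j.

(* The monomial x^a; meaningful only for a >= 0, the only case used below. *)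
Definition zmon (k : fieldType) n (a : zdeg n) : {mpoly k[n]} :=
  'X_[[multinom `|a j|%N | j < n]].

(* p lies in the degree a component of k[x_1, ..., x_n], which is k x^a
   if a >= 0 and 0 otherwise. *)
Definition mhomog (k : fieldType) n (a : zdeg n) (p : {mpoly k[n]}) : Prop :=
  forall m, m \in msupp p -> forall j, (m j)%:Z = a j.

Fact mhomog_sum (k : fieldType) n (a : zdeg n) (T : Type) (r : seq T)
    (F : T -> {mpoly k[n]}) :
  (forall t, mhomog a (F t)) -> mhomog a (\sum_(t <- r) F t).
Proof.
move=> hF; elim/big_rec: _ => [m|t p _ hp m]; first by rewrite msupp0.
by move/msuppD_le; rewrite mem_cat => /orP[/hF|/hp].
Qed.

Fact mhomogM (k : fieldType) n (a b : zdeg n) (p q : {mpoly k[n]}) :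
  mhomog a p -> mhomog b q -> mhomog (a + b) (p * q).
Proof.
move=> hp hq m /msuppM_le/allpairsP[[u v] /= [/hp hu /hq hv ->]] j.
by rewrite mnmDE PoszD hu hv ffunE.
Qed.

Fact mhomogZ (k : fieldType) n (a : zdeg n) (c : k) (p : {mpoly k[n]}) :
  mhomog a p -> mhomog a (c *: p).
Proof. by move=> hp m /msuppZ_le/hp. Qed.

Fact mhomog_zmon (k : fieldType) n (a : zdeg n) :
  (forall j, 0 <= a j) -> mhomog a (zmon k a).
Proof.
move=> a_ge0 m; rewrite msuppX inE => /eqP-> j.
by rewrite mnmE gez0_abs.
Qed.

(* The data (X, gdeg) stands for the graded free R-module
   \bigoplus_(x : X) R(- gdeg x), whose carrier is {ffun X -> R^o}. *)
Record gfree (n : nat) := GFree { gidx :> finType; gdeg : gidx -> zdeg n }.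

Notation gcarrier k n X := {ffun gidx X -> {mpoly k[n]}^o}.

Definition ghomog (k : fieldType) n (X : gfree n) (g : zdeg n)
    (v : gcarrier k n X) : Prop :=
  forall x, mhomog (g - gdeg x) (v x).

Definition deg_preserving (k : fieldType) n (X Y : gfree n)
    (f : gcarrier k n X -> gcarrier k n Y) : Prop :=
  forall g v, ghomog g v -> ghomog g (f v).

Definition homog_basis (k : fieldType) n (X T : gfree n)
    (b : T -> gcarrier k n X) : Prop :=
  (forall t, ghomog (gdeg t) (b t)) /\
  (forall v, exists! c : {ffun T -> {mpoly k[n]}}, v = \sum_t c t *: b t).

(* A sequence F_0 <- F_1 <- F_2 <- ..., not assumed to be a complex;
   [gdiff F i] is the map phi_(i+1) : F_(i+1) -> F_i. *)
Record gseq (k : fieldType) (n : nat) := GSeq {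
  gmod :> nat -> gfree n;
  gdiff : forall i, {linear gcarrier k n (gmod i.+1) -> gcarrier k n (gmod i)};
  gdiffP : forall i, deg_preserving (gdiff i) }.

Definition gseq_iso (k : fieldType) n (F G : gseq k n) : Prop :=
  exists f : forall i, {linear gcarrier k n (F i) -> gcarrier k n (G i)},
    [/\ forall i, bijective (f i),
        forall i, deg_preserving (f i)
      & forall i v, f i (gdiff F i v) = gdiff G i (f i.+1 v)].

Definition monomial_ideal (k : fieldType) n (I : {mpoly k[n]} -> Prop) : Prop :=
  exists G : 'X_{1..n} -> Prop, forall p, I p <->
    exists s : seq ({mpoly k[n]} * 'X_{1..n}),
      (forall u, u \in s -> G u.2) /\ p = \sum_(u <- s) u.1 * 'X_[u.2].

(* Minimality is phi_i(F_i) \subset (x_1, ..., x_n) F_(i-1). *)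
Record minimal_resolution (k : fieldType) n (I : {mpoly k[n]} -> Prop)
    (F : gseq k n) (m : nat) : Prop := MinimalResolution {
  mr_length : forall i, (m < i)%N -> #|F i| = 0%N;
  mr_augmentation : exists eps : {linear gcarrier k n (F 0%N) -> {mpoly k[n]}^o},
    [/\ forall g v, ghomog g v -> mhomog g (eps v),
        forall p, I p <-> exists v, eps v = p
      & forall v, eps v = 0 <-> exists w, gdiff F 0%N w = v];
  mr_exact : forall i v, gdiff F i v = 0 <-> exists w, gdiff F i.+1 w = v;
  mr_minimal : forall i w (x : F i), (gdiff F i w x : {mpoly k[n]})@_0%MM = 0 }.

Definition pure_resolution (k : fieldType) n (F : gseq k n) : Prop :=
  forall i, exists d : int, forall x : F i, total_deg (gdeg x) = d.

Definition covers d (P : finPOrderType d) (y x : P) : bool :=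
  (y < x)%O && [forall z, ~~ (y < z < x)%O].

(* m is any bound on the length of F: F_i = 0 for i > m. *)
Definition betti_degs (k : fieldType) n (F : gseq k n) (m : nat) :
    seq (zdeg n) :=
  flatten [seq [seq gdeg x | x : F i] | i <- iota 0 m.+1].

Definition betti_poset (k : fieldType) n (F : gseq k n) (m : nat) :=
  seq_sub (betti_degs F m).
HB.instance Definition _ (k : fieldType) n (F : gseq k n) m :=
  SubFinite.on (betti_poset F m).
HB.instance Definition _ (k : fieldType) n (F : gseq k n) m :=
  [SubChoice_isSubPOrder of betti_poset F m by <: with zdeg_display].

Definition betti_incl (k : fieldType) n (F : gseq k n) m
  (x : betti_poset F m) : zdeg n := val x.

Fact betti_incl_homo (k : fieldType) n (F : gseq k n) m :
  {homo @betti_incl k n F m : x y / (x <= y)%O}.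
Proof. by []. Qed.

Definition betti_linear (k : fieldType) n (F : gseq k n) (m : nat) : Prop :=
  exists (T : nat -> gfree n) (b : forall t, T t -> gcarrier k n (F t)),
    (forall t, homog_basis (b t)) /\
    forall i (tau : T i.+1) (c : T i -> {mpoly k[n]}),
      gdiff F i (b i.+1 tau) = \sum_gamma c gamma *: b i gamma ->
      forall gamma, c gamma != 0 ->
        exists y x : betti_poset F m,
          [/\ betti_incl y = gdeg gamma, betti_incl x = gdeg tau & covers y x].

Section Homology.
Variables (k : fieldType) (d : Order.disp_t) (P : finPOrderType d).
Implicit Types (s : {set P}) (D : {set {set P}}).

(* A complex is its set of faces (including the empty face set0); a chain is
   a k-valued function on finite subsets of P. *)
Notation chain := {ffun {set P} -> k^o}.

Definition face_vec s : chain := [ffun t => (t == s)%:R].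

(* Faces are chains of P, oriented by increasing order of the vertices:
   #|[set y in s | y < x]| is the position of x in s. *)
Definition face_boundary s : chain :=
  \sum_(x in s) (-1) ^+ #|[set y in s | (y < x)%O]| *: face_vec (s :\ x).

Definition boundary_fun (c : chain) : chain := \sum_s c s *: face_boundary s.

Fact boundary_fun_is_linear : linear boundary_fun.
Proof.
move=> a u v; rewrite /boundary_fun scaler_sumr -big_split /=.
by apply: eq_bigr => s _; rewrite !ffunE scalerDl scalerA.
Qed.
HB.instance Definition _ :=
  GRing.isLinear.Build k chain chain *:%R boundary_fun boundary_fun_is_linear.

Definition boundary : 'End(chain) := linfun boundary_fun.

(* The index i counts vertices: chains, cycles, boundaries and homology in
   dimension i - 1. *)
Definition chains i D : {vspace chain} :=
  <<[seq face_vec s | s <- enum D & #|s| == i]>>%VS.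
Definition cycles i D : {vspace chain} := (chains i D :&: lker boundary)%VS.
Definition boundaries i D : {vspace chain} := (boundary @: chains i.+1 D)%VS.

(* The reduced homology \tilde H_(i-1)(D, k). The quotient Z / B is realized
   on the complement Z :\: B of B in Z; the class of a cycle is its projection
   to that complement along B. *)
Definition homology i D : vectType k :=
  subvs_of (cycles i D :\: boundaries i D).
Definition hclass i D (c : chain) : homology i D :=
  vsproj _ (addv_pi1 (cycles i D) (boundaries i D) c).
Definition hrepr i D (h : homology i D) : chain := vsval h.

Definition restrict D (c : chain) : chain :=
  [ffun s => if s \in D then c s else 0].

Definition order_complex (A : {set P}) : {set {set P}} :=
  [set s : {set P} | (s \subset A) &&
     [forall x in s, forall y in s, (x >=< y)%O]].

Definition cx_lt (a : P) := order_complex [set y | (y < a)%O].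
Definition cx_le (a : P) := order_complex [set y | (y <= a)%O].

(* The union of the Delta_{<= b} over the covers b <> l of a, with the
   convention that the empty union is {set0}. *)
Definition cx_other (a l : P) : {set {set P}} :=
  set0 |: \bigcup_(b | covers b a && (b != l)) cx_le b.
Definition cx_int (a l : P) := cx_le l :&: cx_other a l.

Definition poset_obj i (a : P) : vectType k := homology i (cx_lt a).

(* The connecting map: c = c' + c'' with c' the part of c on the faces of
   Delta_{<= l}. *)
Definition mv_connect i (a l : P) (h : homology i.+1 (cx_lt a)) :
    homology i (cx_int a l) :=
  hclass i (cx_int a l) (boundary (restrict (cx_le l) (hrepr h))).

Definition mv_incl i (a l : P) (h : homology i (cx_int a l)) :
    homology i (cx_lt l) :=
  hclass i (cx_lt l) (hrepr h).

(* phi_(i+1)^(a,l), for l covered by a *)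
Definition poset_map i (a l : P) (h : poset_obj i.+1 a) : poset_obj i l :=
  mv_incl (mv_connect l h).

Fact poset_map_is_linear i (a l : P) : linear (@poset_map i a l).
Proof.
have restrictP D : linear (restrict D).
  move=> x u v; apply/ffunP => s; rewrite !ffunE.
  by case: ifP => // _; rewrite scaler0 addr0.
move=> x u v; rewrite /poset_map /mv_incl /mv_connect /hclass /hrepr.
by rewrite linearP restrictP !linearP.
Qed.
HB.instance Definition _ i (a l : P) :=
  GRing.isLinear.Build k (poset_obj i.+1 a) (poset_obj i l) *:%R
    (@poset_map i a l) (@poset_map_is_linear i a l).

End Homology.

Section Homogenization.
Variables (k : fieldType) (n : nat) (d : Order.disp_t) (P : finPOrderType d).
Variables (eta : P -> zdeg n) (eta_homo : {homo eta : x y / (x <= y)%O}).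

(* The basis of D_{i,a} \otimes R(- eta a) is the chosen basis of D_{i,a}. *)
Definition hmg_mod i : gfree n :=
  @GFree n {a : P & 'I_(\dim {:poset_obj k i a})} (fun u => eta (tag u)).

Definition hmg_coef i (u : hmg_mod i.+1) (v : hmg_mod i) : {mpoly k[n]} :=
  if covers (tag v) (tag u) then
    coord (vbasis {:poset_obj k i (tag v)}) (tagged v)
      (poset_map (tag v) (vbasis {:poset_obj k i.+1 (tag u)})`_(tagged u))
    *: zmon k (eta (tag u) - eta (tag v))
  else 0.

Definition hmg_diff i (f : gcarrier k n (hmg_mod i.+1)) :
    gcarrier k n (hmg_mod i) :=
  [ffun v => \sum_u f u * hmg_coef u v].

Fact hmg_diff_is_linear i : linear (@hmg_diff i).
Proof.
move=> a f g; apply/ffunP => v; rewrite !ffunE scaler_sumr -big_split /=.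
by apply: eq_bigr => u _; rewrite !ffunE mulrDl -scalerAl.
Qed.
HB.instance Definition _ i :=
  GRing.isLinear.Build {mpoly k[n]} (gcarrier k n (hmg_mod i.+1))
    (gcarrier k n (hmg_mod i)) *:%R (@hmg_diff i) (@hmg_diff_is_linear i).

Fact hmg_diffP i : deg_preserving (@hmg_diff i).
Proof.
move=> g f hf v; rewrite ffunE; apply: mhomog_sum => u.
rewrite /hmg_coef; case: ifP => [/andP[/ltW/eta_homo le_vu _]|_]; last first.
  by rewrite mulr0 => m; rewrite msupp0.
have -> : g - gdeg v = (g - gdeg u) + (eta (tag u) - eta (tag v)).
  by rewrite addrA subrK.
apply: mhomogM; first exact: hf.
apply/mhomogZ/mhomog_zmon => j.
by rewrite !ffunE subr_ge0; exact: (forallP le_vu).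
Qed.

Definition homogenization : gseq k n :=
  @GSeq k n hmg_mod (fun i => @hmg_diff i) hmg_diffP.

End Homogenization.

(* Main.v *)
From HB Require Import structures.
Require Import Defs.
From mathcomp Require Import all_boot all_order all_algebra.
From mathcomp Require Import mpoly.

(** Setting all variables to 1 turns the resolution into an augmented complex
    of k-vector spaces C filtered by the Betti poset B, and C_{<= a} is exact
    for every a in B because it is the degree-a strand of the resolution.
    Coning off at the degree of each basis element gives a chain map g from C
    to the chains of the order complex of B, carrying C_{<= a} into
    Delta_{<= a}.  Both sides are exact over principal ideals, so by
    Mayer-Vietoris the mapping cone of g is exact over every down-closed
    subset; over B_{< a} this shows that tau |-> [g (d tau)] maps the basis
    elements of degree a to a basis of the reduced homology of Delta_a.  If d
    only involves covers, then g (d tau) is split along the covers l of a into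
    chains supported on Delta_{<= l}, and the connecting maps can be read off
    this splitting: they have the same matrix as d.  For a pure resolution the
    total degrees increase strictly with the homological degree, which leaves
    no room for a Betti degree between those of tau and of a basis element
    occurring in d tau. *)

Set Implicit Arguments.
Unset Strict Implicit.
Unset Printing Implicit Defensive.

Import Order.TTheory GRing.Theory Num.Theory.
Local Open Scope ring_scope.

Section OrderComplex.
Variables (d : Order.disp_t) (P : finPOrderType d).
Implicit Types (s t : {set P}) (D : {set {set P}}) (A : {set P}).

Definition subcomplex D := forall s x, s \in D -> s :\ x \in D.

Lemma order_complexP A s :
  reflect ({subset s <= A} /\ {in s &, forall x y, (x >=< y)%O})
          (s \in order_complex A).
Proof.
rewrite inE; apply: (iffP andP) => [[/subsetP sA cs]|[sA cs]]; split=> //.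
- by move=> x y xs ys; move/forall_inP: cs => /(_ x xs)/forall_inP/(_ y ys).
- exact/subsetP.
- by apply/forall_inP => x xs; apply/forall_inP => y; apply: cs.
Qed.

Lemma order_complex0 A : set0 \in order_complex A.
Proof. by apply/order_complexP; split=> x; rewrite inE. Qed.

Lemma order_complex_sub A s t :
  t \subset s -> s \in order_complex A -> t \in order_complex A.
Proof.
move=> /subsetP ts /order_complexP[sA cs]; apply/order_complexP; split.
  by move=> x /ts/sA.
by move=> x y /ts xs /ts ys; apply: cs.
Qed.

Lemma order_complexS A (B : {set P}) : A \subset B ->
  order_complex A \subset order_complex B.
Proof.
move=> /subsetP AB; apply/subsetP => s /order_complexP[sA cs].
by apply/order_complexP; split=> // x /sA/AB.
Qed.

Lemma order_complex_subcomplex A : subcomplex (order_complex A).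
Proof. by move=> s x; apply: order_complex_sub; apply: subsetDl. Qed.

Lemma order_complex_restrict A (B : {set P}) s :
  s \in order_complex A -> s \subset B -> s \in order_complex B.
Proof.
move=> /order_complexP[_ cs] /subsetP sB.
by apply/order_complexP; split.
Qed.

Lemma chain_has_max A s : s \in order_complex A -> s != set0 ->
  exists2 x, x \in s & {in s, forall y, (y <= x)%O}.
Proof.
move=> /order_complexP[_ cs] /set0Pn[x0 x0s].
case: (arg_maxnP (fun x => #|[set y in s | (y <= x)%O]|) x0s) => x xs xmax.
exists x => // y ys; case/orP: (cs x y xs ys) => // le_xy.
have /eqP <- // : y == x.
rewrite eq_le le_xy andbT.
have sub: [set z in s | (z <= x)%O] \subset [set z in s | (z <= y)%O].
  by apply/subsetP => z; rewrite !inE => /andP[-> /le_trans->].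
have /= := xmax y ys; rewrite (geq_leqif (subset_leqif_card sub)) => /subsetP.
by move=> /(_ y); rewrite !inE ys lexx => /(_ isT).
Qed.

Lemma cover_above (b a : P) : (b < a)%O -> exists2 l, covers l a & (b <= l)%O.
Proof.
move=> lt_ba.
case: (@arg_maxnP _ b (fun x => (b <= x)%O && (x < a)%O)
   (fun x => #|[set y | (y <= x)%O]|)) => [|l]; first by rewrite lexx.
case/andP=> le_bl lt_la lmax; exists l => //.
rewrite /covers lt_la /=; apply/forallP => z; apply/negP => /andP[lt_lz lt_za].
have := lmax z; rewrite (le_trans le_bl (ltW lt_lz)) lt_za => /(_ isT).
apply/negP; rewrite -ltnNge; apply: proper_card; apply/properP; split.
  by apply/subsetP => y; rewrite !inE => /le_trans->//; exact: ltW.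
by exists z; rewrite !inE ?lexx // lt_geF.
Qed.

End OrderComplex.

Section Chains.
Variables (k : fieldType) (d : Order.disp_t) (P : finPOrderType d).
Implicit Types (s t : {set P}) (D : {set {set P}}) (A : {set P}) (a l : P).
Notation chain := {ffun {set P} -> k^o}.
Implicit Type c : chain.
Notation "\bd" := (boundary k P).

Lemma chain_sum c : c = \sum_s c s *: face_vec k s.
Proof.
apply/ffunP => t; rewrite sum_ffunE (bigD1 t) //= big1 ?addr0 => [|s nst].
  by rewrite !ffunE eqxx [_ *: _]mulr1.
by rewrite !ffunE eq_sym (negbTE nst) scaler0.
Qed.

Lemma chainsP i D c :
  reflect (forall s, c s != 0 -> (s \in D) && (#|s| == i)) (c \in chains k i D).
Proof.
apply: (iffP idP) => [cD s|cD].
  apply: contraNT => nsD; pose u := in_tuple [seq face_vec k s | s <- enum D & #|s| == i].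
  rewrite (coord_span (X := u) cD) sum_ffunE big1 // => j _; rewrite ffunE.
  have /mapP[t] : u`_j \in [seq face_vec k s | s <- enum D & #|s| == i].
    exact: mem_nth.
  rewrite mem_filter mem_enum => /andP[ti tD] ->; rewrite ffunE.
  case: eqP => [st|_]; last by rewrite scaler0.
  by move: nsD; rewrite st tD ti.
rewrite [c]chain_sum; apply: memv_suml => s _.
have [->|/cD/andP[sD si]] := eqVneq (c s) 0; first by rewrite scale0r mem0v.
apply/memvZ/memv_span/map_f; by rewrite mem_filter si mem_enum.
Qed.

Lemma chains_neq0 i D c s : c \in chains k i D -> c s != 0 ->
  s \in D /\ #|s| = i.
Proof. by move/chainsP=> cD /cD/andP[-> /eqP]. Qed.

Lemma chainsS i D D' : D \subset D' -> (chains k i D <= chains k i D')%VS.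
Proof.
move=> /subsetP DD'; apply/subvP => c /chainsP cD; apply/chainsP => s /cD.
by case/andP=> /DD' -> ->.
Qed.

Lemma chainsI i D D' c : c \in chains k i D -> c \in chains k i D' ->
  c \in chains k i (D :&: D').
Proof.
move=> /chainsP cD /chainsP cD'; apply/chainsP => s cs.
by rewrite inE; case/andP: (cD s cs) => -> ->; case/andP: (cD' s cs) => ->.
Qed.

Lemma face_vec_chains i D s : s \in D -> #|s| = i -> face_vec k s \in chains k i D.
Proof.
move=> sD si; apply/chainsP => t; rewrite ffunE; case: (t =P s) => [->|_].
  by rewrite sD si eqxx.
by rewrite eqxx.
Qed.

Lemma boundary_sum c : \bd c = \sum_s c s *: face_boundary k s.
Proof. by rewrite lfunE. Qed.

Lemma boundary_face s : \bd (face_vec k s) = face_boundary k s.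
Proof.
rewrite boundary_sum (bigD1 s) //= big1 ?addr0 => [|t /negbTE nts].
  by rewrite ffunE eqxx scale1r.
by rewrite ffunE nts scale0r.
Qed.

Lemma boundary_chains i D c : subcomplex D -> c \in chains k i.+1 D ->
  \bd c \in chains k i D.
Proof.
move=> Dsub cD; rewrite boundary_sum; apply: memv_suml => s _.
have [->|/(chains_neq0 cD)[sD si]] := eqVneq (c s) 0.
  by rewrite scale0r mem0v.
apply/memvZ/memv_suml => x xs; apply/memvZ/face_vec_chains; first exact: Dsub.
by move: si; rewrite (cardsD1 x) xs => -[].
Qed.

Lemma boundary_chains0 D c : c \in chains k 0 D -> \bd c = 0.
Proof.
move=> cD; rewrite boundary_sum big1 // => s _.
have [->|/(chains_neq0 cD)[_ /eqP]] := eqVneq (c s) 0; first by rewrite scale0r.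
rewrite cards_eq0 => /eqP->; rewrite /face_boundary big1 ?scaler0 // => x.
by rewrite inE.
Qed.

Definition cone_fun a c : chain := [ffun t : {set P} => if a \in t then c (t :\ a) else 0].

Fact cone_fun_is_linear a : linear (cone_fun a).
Proof.
move=> x u v; apply/ffunP => t; rewrite !ffunE; case: ifP => // _.
by rewrite scaler0 addr0.
Qed.
HB.instance Definition _ a :=
  GRing.isLinear.Build k chain chain *:%R (cone_fun a) (cone_fun_is_linear a).

Lemma cone_face a s :
  cone_fun a (face_vec k s) = if a \in s then 0 else face_vec k (a |: s).
Proof.
apply/ffunP => t; rewrite ffunE; case: ifP => [a_t|a_t].
  rewrite ffunE; case: ifP => a_s.
    by rewrite ffunE; case: eqP a_s => // <-; rewrite !inE eqxx.
  rewrite ffunE; congr (_%:R); congr nat_of_bool.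
  apply/eqP/eqP => [<-|->]; first by rewrite setD1K.
  by rewrite setU1K ?a_s.
case: ifP => a_s; rewrite ffunE //; case: eqP => // ts.
by rewrite ts !inE eqxx in a_t.
Qed.

Lemma face_boundary_setU1 a s : {in s, forall x, (x < a)%O} ->
  face_boundary k (a |: s) =
    cone_fun a (face_boundary k s) + (-1) ^+ #|s| *: face_vec k s.
Proof.
move=> sa; have a_s : a \notin s by apply/negP => /sa; rewrite ltxx.
rewrite {1}/face_boundary big_setU1 //= addrC; congr (_ + _).
  rewrite linear_sum; apply: eq_bigr => x xs; rewrite linearZ /= cone_face.
  have xa : x != a by apply: contraNneq a_s => <-.
  rewrite !inE (negbTE a_s) andbF; congr (_ ^+ _ *: face_vec k _).
    apply: eq_card => y; rewrite !inE; case: eqP => //= ->.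
    by rewrite (negbTE a_s) lt_gtF // sa.
  by apply/setP => y; rewrite !inE; case: (y =P a) => [->|]; rewrite ?(eq_sym a) ?xa.
rewrite setU1K //; congr (_ ^+ _ *: _); apply: eq_card => y; rewrite !inE.
by case: (y =P a) => [->|_] /=; [rewrite ltxx (negbTE a_s) | apply: andb_idr; apply: sa].
Qed.

Lemma cone_cone a c : cone_fun a (cone_fun a c) = 0.
Proof. by apply/ffunP => t; rewrite !ffunE !inE eqxx; case: ifP. Qed.

Lemma boundary_cone_face a s : {in s, forall x, (x <= a)%O} ->
  \bd (cone_fun a (face_vec k s)) =
    cone_fun a (face_boundary k s) + (-1) ^+ #|s| *: face_vec k s.
Proof.
move=> sa; rewrite cone_face; case: ifP => a_s.
  rewrite linear0 -(setD1K a_s) face_boundary_setU1; last first.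
    by move=> x; rewrite !inE lt_neqAle => /andP[-> /sa].
  rewrite linearD linearZ /= cone_cone add0r cone_face !inE eqxx /=.
  by rewrite cardsU1 !inE eqxx /= exprS mulN1r scaleNr addrN.
rewrite boundary_face face_boundary_setU1 // => x xs.
by rewrite lt_neqAle sa // andbT; apply: contraFneq a_s => <-.
Qed.

Lemma cone_chains i a c : c \in chains k i (cx_le a) ->
  cone_fun a c \in chains k i.+1 (cx_le a).
Proof.
move=> cD; apply/chainsP => t; rewrite ffunE; case: ifP => [a_t|_].
  move/(chains_neq0 cD) => [/order_complexP[ta ct] <-].
  rewrite [#|t|](cardsD1 a) a_t eqxx andbT; apply/order_complexP.
  rewrite -(setD1K a_t); split=> [x|x y].
    by move/setU1P=> [->|/ta//]; rewrite inE.
  move=> /setU1P[->|xt] /setU1P[->|yt]; last exact: ct.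
  - exact: comparablexx.
  - by rewrite comparable_sym le_comparable //; have := ta _ yt; rewrite inE.
  - by rewrite le_comparable //; have := ta _ xt; rewrite inE.
by rewrite eqxx.
Qed.

Lemma boundary_cone i a c : c \in chains k i (cx_le a) ->
  \bd (cone_fun a c) = cone_fun a (\bd c) + (-1) ^+ i *: c.
Proof.
move=> cD; rewrite {1 3}[c]chain_sum (boundary_sum c) !linear_sum.
rewrite -big_split /=; apply: eq_bigr => s _; rewrite !linearZ /=.
have [->|/(chains_neq0 cD)[/order_complexP[sa cs] <-]] := eqVneq (c s) 0.
  by rewrite !scale0r ?scaler0 ?addr0.
rewrite boundary_cone_face; last by move=> x /sa; rewrite inE.
by rewrite scalerDr.
Qed.

Lemma face_boundary_boundary A s : s \in order_complex A ->
  \bd (face_boundary k s) = 0.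
Proof.
have [r] := ubnP #|s|; elim: r s => // r IH s /ltnSE sr sA.
have [s0|s_neq0] := eqVneq s set0.
  by rewrite s0 /face_boundary big1 ?linear0 // => x; rewrite inE.
have [x xs xmax] := chain_has_max sA s_neq0.
pose t := s :\ x; have ts : t \subset s by apply: subsetDl.
have tlt : {in t, forall y, (y < x)%O}.
  by move=> y; rewrite !inE lt_neqAle => /andP[-> /xmax].
have tr : (#|t| < r)%N by move: sr; rewrite (cardsD1 x) xs.
rewrite -(setD1K xs) face_boundary_setU1 // linearD linearZ /= boundary_face.
have tx : t \in cx_le x.
  apply: (order_complex_restrict (order_complex_sub ts sA)).
  by apply/subsetP => y /tlt/ltW; rewrite inE.
case E : #|t| => [|i].
  move/eqP: E; rewrite cards_eq0 => /eqP E; rewrite -/t E /face_boundary.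
  by rewrite !big1 ?linear0 ?scaler0 ?addr0 // => y; rewrite inE.
rewrite (@boundary_cone i); last first.
  rewrite -boundary_face; apply: boundary_chains (face_vec_chains tx E).
  exact: order_complex_subcomplex.
rewrite IH ?(order_complex_sub ts) // linear0 add0r exprS mulN1r scaleNr.
by rewrite addrN.
Qed.

Lemma boundary_boundary i A c : c \in chains k i (order_complex A) ->
  \bd (\bd c) = 0.
Proof.
move=> cA; rewrite (boundary_sum c) linear_sum big1 // => s _; rewrite linearZ /=.
have [->|/(chains_neq0 cA)[sA _]] := eqVneq (c s) 0; first by rewrite scale0r.
by rewrite (face_boundary_boundary sA) scaler0.
Qed.

Lemma cx_le_acyclic i a c : c \in chains k i (cx_le a) -> \bd c = 0 ->
  exists2 w, w \in chains k i.+1 (cx_le a) & \bd w = c.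
Proof.
move=> ca c0; exists ((-1) ^+ i *: cone_fun a c).
  exact/memvZ/cone_chains.
rewrite linearZ /= (boundary_cone ca) c0 linear0 add0r scalerA -exprMn.
by rewrite mulrNN mulr1 expr1n scale1r.
Qed.

End Chains.

Section HomologyClasses.
Variables (k : fieldType) (d : Order.disp_t) (P : finPOrderType d).
Implicit Types (s t : {set P}) (D : {set {set P}}) (A : {set P}) (a l : P).
Notation chain := {ffun {set P} -> k^o}.
Implicit Type c : chain.
Notation "\bd" := (boundary k P).

Fact hclass_is_linear i D : linear (@hclass k d P i D).
Proof. by move=> x u v; rewrite /hclass !linearP. Qed.
HB.instance Definition _ i D :=
  GRing.isLinear.Build k chain (homology k i D) *:%R (@hclass k d P i D)
    (@hclass_is_linear i D).

Lemma cyclesP i D c :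
  reflect (c \in chains k i D /\ \bd c = 0) (c \in cycles k i D).
Proof.
rewrite memv_cap memv_ker.
by apply: (iffP andP) => -[cD /eqP]; split=> //; apply/eqP.
Qed.

Lemma boundariesP i D c :
  reflect (exists2 w, w \in chains k i.+1 D & c = \bd w)
          (c \in boundaries k i D).
Proof. exact: memv_imgP. Qed.

Lemma hrepr_hclass i D c : c \in cycles k i D ->
  exists2 b, b \in boundaries k i D & hrepr (hclass i D c) = c - b.
Proof.
move=> cZ; exists (addv_pi2 (cycles k i D) (boundaries k i D) c).
  exact: memv_pi2.
rewrite /hrepr /hclass vsprojK; last exact: memv_pi.
rewrite -{2}(@addv_pi1_pi2 _ _ (cycles k i D) (boundaries k i D) c) ?addrK //.
exact: subvP (addvSl _ _) _ cZ.
Qed.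

Lemma hclass_boundary i D c : c \in boundaries k i D -> hclass i D c = 0.
Proof.
move=> cB; apply: val_inj; rewrite /= /hclass vsprojK; last exact: memv_pi.
have cS : c \in (cycles k i D + boundaries k i D)%VS.
  exact: subvP (addvSr _ _) _ cB.
by apply: (addIr c); rewrite -{2}(addv_pi2_id (cycles k i D) cB) addv_pi1_pi2 // add0r.
Qed.

Lemma hclass_eq0 i D c : c \in cycles k i D -> hclass i D c = 0 ->
  c \in boundaries k i D.
Proof.
move=> /hrepr_hclass[b bB e] c0; move: e.
by rewrite c0 /hrepr linear0 => /eqP; rewrite eq_sym subr_eq0 => /eqP->.
Qed.

Lemma hrepr_cycle i D (h : homology k i D) : hrepr h \in cycles k i D.
Proof. exact: subvP (diffvSl _ _) _ (valP h). Qed.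

Lemma hreprK i D (h : homology k i D) : hclass i D (hrepr h) = h.
Proof.
apply: val_inj; rewrite /= /hclass vsprojK; last exact: memv_pi.
rewrite /addv_pi1 daddv_pi_id ?capv_diff //; exact: valP.
Qed.

Lemma hclass_congr i D c c' : c - c' \in boundaries k i D ->
  hclass i D c = hclass i D c'.
Proof. by move/hclass_boundary/eqP; rewrite linearB subr_eq0 => /eqP. Qed.

Fact restrict_is_linear D : linear (@restrict k d P D).
Proof.
move=> x u v; apply/ffunP => s; rewrite !ffunE.
by case: ifP => // _; rewrite scaler0 addr0.
Qed.
HB.instance Definition _ D :=
  GRing.isLinear.Build k chain chain *:%R (@restrict k d P D)
    (restrict_is_linear D).

Lemma restrict_chains i D D' c : c \in chains k i D' ->
  restrict D c \in chains k i (D :&: D').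
Proof.
move=> cD; apply/chainsP => s; rewrite ffunE inE; case: ifP; rewrite ?eqxx //.
by move=> sD /(chains_neq0 cD)[-> ->]; rewrite eqxx.
Qed.

Lemma restrict_id i D c : c \in chains k i D -> restrict D c = c.
Proof.
move=> cD; apply/ffunP => s; rewrite ffunE; case: ifP => // sD.
by apply/esym; apply: contraFeq sD => /(chains_neq0 cD)[].
Qed.

Lemma restrictC_chains i D D' D'' c : c \in chains k i D' ->
  D' \subset D :|: D'' -> c - restrict D c \in chains k i D''.
Proof.
move=> cD /subsetP sub; apply/chainsP => s; rewrite !ffunE.
case: ifP => sD; rewrite ?subrr ?eqxx // subr0 => /(chains_neq0 cD)[sD' ->].
by rewrite eqxx andbT; have := sub s sD'; rewrite inE sD.
Qed.

Lemma cx_other_subcomplex a l : subcomplex (cx_other a l).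
Proof.
move=> s x; rewrite !inE => /orP[/eqP->|/bigcupP[b ab sb]].
  by rewrite set0D eqxx.
apply/orP; right; apply/bigcupP; exists b => //.
exact: order_complex_subcomplex.
Qed.

Lemma cx_lt_cover a l : cx_lt a \subset cx_le l :|: cx_other a l.
Proof.
apply/subsetP => s sa; rewrite !in_setU.
have [->|s0] := eqVneq s set0; first by rewrite order_complex0.
have [x xs xmax] := chain_has_max sa s0.
have [sa' _] := order_complexP _ _ sa.
have := sa' x xs; rewrite inE => /cover_above[b ab xb].
have sb : s \in cx_le b.
  apply: (order_complex_restrict sa); apply/subsetP => y /xmax yx.
  by rewrite inE (le_trans yx).
have [<-|bl] := eqVneq b l; first by rewrite sb.
by apply/orP; right; apply/orP; right; apply/bigcupP; exists b; rewrite ?ab.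
Qed.

Lemma cx_int_lt a l : covers l a -> cx_int a l \subset cx_lt l.
Proof.
case/andP=> la /forallP nla; apply/subsetP => s.
rewrite !in_setI in_setU in_set1 => /andP[sl].
case/orP=> [/eqP->|/bigcupP[b /andP[/andP[ba _] bl] sb]].
  exact: order_complex0.
apply: (order_complex_restrict sl); apply/subsetP => x xs.
have [/(_ x xs) + _] := order_complexP _ _ sl.
have [/(_ x xs) + _] := order_complexP _ _ sb.
rewrite !inE lt_neqAle => xb xl; rewrite xl andbT.
apply: contraNneq (nla b) => xeq; rewrite ba andbT lt_neqAle eq_sym bl.
by rewrite -xeq.
Qed.

Lemma cx_int_subcomplex a l : subcomplex (cx_int a l).
Proof.
move=> s x; rewrite !in_setI => /andP[sl so].
by rewrite order_complex_subcomplex // cx_other_subcomplex.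
Qed.

Lemma boundariesS i D D' : D \subset D' ->
  (boundaries k i D <= boundaries k i D')%VS.
Proof. by move=> DD'; apply/limgS/chainsS. Qed.

(* Neither the choice of representative of [c] nor that of its Mayer-Vietoris
   decomposition matters: two choices differ by a chain of Delta_{a,l}. *)
Lemma poset_map_hclass i a l c c' c'' : covers l a ->
  c \in cycles k i.+1 (cx_lt a) -> c' \in chains k i.+1 (cx_le l) ->
  c'' \in chains k i.+1 (cx_other a l) -> c = c' + c'' ->
  poset_map l (hclass i.+1 (cx_lt a) c) = hclass i (cx_lt l) (\bd c').
Proof.
move=> la cZ c'D c''D cE; rewrite /poset_map /mv_incl /mv_connect.
have [_ /boundariesP[w wD ->] ->] := hrepr_hclass cZ.
pose w' := restrict (cx_le l) w.
have w'D : w' \in chains k i.+2 (cx_le l).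
  by apply: subvP (restrict_chains _ wD); apply/chainsS/subsetIl.
have w''D : w - w' \in chains k i.+2 (cx_other a l).
  exact: restrictC_chains wD (cx_lt_cover a l).
have bw'D : \bd w' \in chains k i.+1 (cx_le l).
  exact: boundary_chains (@order_complex_subcomplex _ _ _) w'D.
have bw''D : \bd (w - w') \in chains k i.+1 (cx_other a l).
  exact: boundary_chains (@cx_other_subcomplex _ _) w''D.
set r := restrict (cx_le l) (c'' - \bd (w - w')).
have rD : r \in chains k i.+1 (cx_int a l).
  by apply: restrict_chains; apply: rpredB.
have -> : restrict (cx_le l) (c - \bd w) = c' - \bd w' + r.
  have -> : c - \bd w = (c' - \bd w') + (c'' - \bd (w - w')).
    by rewrite (linearB (boundary k P)) cE opprB addrACA addKr.
  by rewrite linearD /= [restrict _ (c' - _)](@restrict_id i.+1) // rpredB.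
have bE : \bd (c' - \bd w' + r) = \bd c' + \bd r.
  by rewrite linearD linearB /= (boundary_boundary w'D) subr0.
rewrite bE.
have bc' : \bd c' \in chains k i (cx_int a l).
  apply: chainsI.
    exact: boundary_chains (@order_complex_subcomplex _ _ _) c'D.
  have -> : \bd c' = - \bd c''.
    have [_ /eqP] := cyclesP _ _ _ cZ.
    by rewrite cE linearD addr_eq0 => /eqP.
  rewrite rpredN; exact: boundary_chains (@cx_other_subcomplex _ _) c''D.
have Z : \bd c' + \bd r \in cycles k i (cx_int a l).
  apply/cyclesP; split.
    rewrite rpredD //; exact: boundary_chains (@cx_int_subcomplex _ _) rD.
  rewrite linearD /= (boundary_boundary c'D) add0r.
  by apply: (@boundary_boundary _ _ _ i.+1 [set y | (y < l)%O]);
     apply: subvP rD; apply/chainsS/cx_int_lt.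
have [b' b'B ->] := hrepr_hclass Z.
apply: hclass_congr; rewrite addrAC [_ - \bd c']addrAC subrr add0r.
apply: (subvP (boundariesS _ (cx_int_lt la))).
by rewrite rpredB //; apply/boundariesP; exists r.
Qed.

End HomologyClasses.

Section Comparison.
Variables (k : fieldType) (d : Order.disp_t) (P : finPOrderType d).
Variables (X : nat -> finType) (lev : forall i, X i -> P).
Variables (a : forall i, X i.+1 -> X i -> k) (e : X 0%N -> k).
Implicit Types (Q : {set P}) (al : P).
Notation chain := {ffun {set P} -> k^o}.
Notation "\bd" := (boundary k P).

(* The augmented complex, shifted so that X i sits in degree i + 2 and the
   target k of the augmentation in degree 1. *)
Definition aug_idx i : finType :=
  match i with 0 => void | 1 => unit | j.+2 => X j end.

Definition aug_in Q i : aug_idx i -> bool :=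
  match i with j.+2 => fun x : X j => lev x \in Q | _ => fun=> true end.

Definition aug_mx i : aug_idx i.+1 -> aug_idx i -> k :=
  match i with 0 => fun _ _ => 0 | 1 => fun x _ => e x | j.+2 => @a j end.

Notation C i := {ffun aug_idx i -> k^o}.

Definition aug_row i (x : aug_idx i.+1) : C i := [ffun y => aug_mx x y].

Definition aug_diff i (v : C i.+1) : C i := \sum_x v x *: aug_row x.

Fact aug_diff_is_linear i : linear (@aug_diff i).
Proof.
move=> b u v; rewrite /aug_diff scaler_sumr -big_split /=.
by apply: eq_bigr => x _; rewrite !ffunE scalerDl scalerA.
Qed.
HB.instance Definition _ i :=
  GRing.isLinear.Build k (C i.+1) (C i) *:%R (@aug_diff i)
    (@aug_diff_is_linear i).

Definition asupp Q i (v : C i) := forall y, v y != 0 -> aug_in Q y.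

Lemma asuppD Q i (u v : C i) : asupp Q u -> asupp Q v -> asupp Q (u + v).
Proof.
move=> su sv y; rewrite ffunE; have [->|/su//] := eqVneq (u y) 0.
by rewrite add0r => /sv.
Qed.

Lemma asuppN Q i (v : C i) : asupp Q v -> asupp Q (- v).
Proof. by move=> sv y; rewrite ffunE oppr_eq0 => /sv. Qed.

Lemma asuppB Q i (u v : C i) : asupp Q u -> asupp Q v -> asupp Q (u - v).
Proof. by move=> su sv; apply/asuppD/asuppN. Qed.

Lemma asupp0 Q i : asupp Q (0 : C i).
Proof. by move=> y; rewrite ffunE eqxx. Qed.

Lemma asuppS Q Q' i (v : C i) : Q \subset Q' -> asupp Q v -> asupp Q' v.
Proof.
move=> /subsetP sQ sv y /sv.
by case: i v sv y => [|[|i]] v sv y //=; apply: sQ.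
Qed.

Lemma asuppI Q Q' i (v : C i) : asupp Q v -> asupp Q' v -> asupp (Q :&: Q') v.
Proof.
move=> sv sv' y vy; move: (sv y vy) (sv' y vy).
by case: i v sv sv' y vy => [|[|i]] v sv sv' y vy //=; rewrite inE => -> ->.
Qed.

Definition arestrict Q i (v : C i) : C i :=
  [ffun y => if aug_in Q y then v y else 0].

Lemma arestrict_supp Q i (v : C i) : asupp Q (arestrict Q v).
Proof. by move=> y; rewrite ffunE; case: ifP; rewrite ?eqxx. Qed.

Lemma arestrictC_supp Q Q1 Q2 i (v : C i) : asupp Q v -> Q \subset Q1 :|: Q2 ->
  asupp Q2 (v - arestrict Q1 v).
Proof.
move=> sv /subsetP sQ y; rewrite !ffunE; case: ifP => yQ1.
  by rewrite subrr eqxx.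
rewrite subr0 => /sv; case: i v sv y yQ1 => [|[|i]] v sv y //= yQ1 /sQ.
by rewrite inE yQ1.
Qed.

Lemma aug_diff_neq0 i (v : C i.+1) y : aug_diff v y != 0 ->
  exists2 x, v x != 0 & aug_mx x y != 0.
Proof.
rewrite sum_ffunE => vy.
have /existsP[x] : [exists x, (v x *: aug_row x) y != 0].
  apply: contraNT vy; rewrite negb_exists => /forallP vy.
  by apply/eqP/big1 => x _; apply/eqP; have := vy x; rewrite negbK.
by rewrite !ffunE mulf_eq0 negb_or => /andP[]; exists x.
Qed.

Lemma aug_diff_supp Q i (v : C i.+1) : asupp Q v ->
  (forall (j : nat) (x : X j.+1) y, a x y != 0 -> lev x \in Q -> lev y \in Q) ->
  asupp Q (aug_diff v).
Proof.
move=> sv sQ y /aug_diff_neq0[x]; case: i v sv x y => [|[|i]] v sv x y //=.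
by move=> vx axy; apply: sQ axy _; exact: sv vx.
Qed.

Hypothesis lev_lt : forall i (x : X i.+1) y, a x y != 0 -> (lev y < lev x)%O.
Hypothesis aug_cx : forall i (w : C i.+2), aug_diff (aug_diff w) = 0.
Hypothesis aug_exact : forall al i (v : C i.+1),
  asupp [set y | (y <= al)%O] v -> aug_diff v = 0 ->
  exists2 w : C i.+2, asupp [set y | (y <= al)%O] w & aug_diff w = v.

Definition down_closed Q := forall x y, x \in Q -> (y <= x)%O -> y \in Q.

Lemma down_closed_le al : down_closed [set y | (y <= al)%O].
Proof. by move=> x y; rewrite !inE => xal /le_trans->. Qed.

Lemma down_closed_lt al : down_closed [set y | (y < al)%O].
Proof. by move=> x y; rewrite !inE => xal /le_lt_trans->. Qed.

Lemma aug_diff_down Q i (v : C i.+1) : down_closed Q -> asupp Q v ->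
  asupp Q (aug_diff v).
Proof.
move=> dQ sv; apply: aug_diff_supp => // j x y /lev_lt/ltW yx xQ.
exact: dQ yx.
Qed.

Lemma aug_diff_lt al i (v : C i.+2) : asupp [set y | (y <= al)%O] v ->
  asupp [set y | (y < al)%O] (aug_diff v).
Proof.
move=> sv y /aug_diff_neq0[x]; case: i v sv x y => [|i] v sv x y //= vx axy.
rewrite inE.
by have := sv x vx; rewrite /= inE; apply: lt_le_trans; apply: lev_lt axy.
Qed.

Lemma aug_diff_delta i (x : aug_idx i.+1) :
  aug_diff [ffun y => (y == x)%:R] = aug_row x.
Proof.
rewrite /aug_diff (bigD1 x) //= ffunE eqxx scale1r big1 ?addr0 // => y nyx.
by rewrite ffunE (negbTE nyx) scale0r.
Qed.

(* A chain map carried by the subcomplexes Delta_{<= al}: the image of x is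
   the cone with apex [lev x] over the image of its boundary. *)
Fixpoint cmp i : aug_idx i.+1 -> chain :=
  match i with
  | 0 => fun _ => face_vec k set0
  | j.+1 => fun x : X j => (-1) ^+ j *: cone_fun (lev x)
      (\sum_(y : aug_idx j.+1) @aug_mx j.+1 x y *: cmp y)
  end.

Definition cmp_map i (v : C i.+1) : chain := \sum_y v y *: cmp y.

Fact cmp_map_is_linear i : linear (@cmp_map i).
Proof.
move=> b u v; rewrite /cmp_map scaler_sumr -big_split /=.
by apply: eq_bigr => x _; rewrite !ffunE scalerDl scalerA.
Qed.
HB.instance Definition _ i :=
  GRing.isLinear.Build k (C i.+1) chain *:%R (@cmp_map i) (@cmp_map_is_linear i).

Lemma cmpS i (x : X i) :
  @cmp i.+1 x = (-1) ^+ i *: cone_fun (lev x) (cmp_map (@aug_row i.+1 x)).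
Proof.
rewrite /= /cmp_map; congr (_ *: cone_fun _ _).
by apply: eq_bigr => y _; rewrite ffunE.
Qed.

Lemma cmp0 (y : unit) : @cmp 0%N y = face_vec k set0.
Proof. by []. Qed.

Local Opaque cmp.

Lemma aug_row_lt i (x : X i) : asupp [set y | (y < lev x)%O] (@aug_row i.+1 x).
Proof.
rewrite -aug_diff_delta; apply: aug_diff_lt => y; rewrite ffunE.
by have [->|] := eqVneq y x; rewrite ?eqxx //= inE lexx.
Qed.

Lemma cmp_map_chains Q i (v : C i.+1) : down_closed Q -> asupp Q v ->
  cmp_map v \in chains k i (order_complex Q).
Proof.
elim: i Q v => [|i IH] Q v dQ sv; apply: memv_suml => x _.
  by rewrite cmp0; apply/memvZ/face_vec_chains; rewrite ?cards0 ?order_complex0.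
have [->|/sv xQ] := eqVneq (v x) 0; first by rewrite scale0r mem0v.
rewrite cmpS; do 2!apply: memvZ.
have sub : cx_le (lev x) \subset order_complex Q.
  by apply/order_complexS/subsetP => y; rewrite inE; apply: dQ.
apply: subvP (chainsS _ _ sub) _ _; apply: cone_chains; apply: IH.
  exact: down_closed_le.
by apply: asuppS _ (@aug_row_lt _ x); apply/subsetP => y; rewrite !inE; apply: ltW.
Qed.

Lemma boundary_cmp_map i (v : C i.+2) : \bd (cmp_map v) = cmp_map (aug_diff v).
Proof.
have inner_le j (x : X j) :
    cmp_map (@aug_row j.+1 x) \in chains k j (cx_le (lev x)).
  apply: cmp_map_chains; first exact: down_closed_le.
  by apply: asuppS _ (@aug_row_lt _ x); apply/subsetP => y; rewrite !inE; apply: ltW.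
have bcmp j : (forall x : X j, \bd (cmp_map (@aug_row j.+1 x)) = 0) ->
    forall u : C j.+2, \bd (cmp_map u) = cmp_map (aug_diff u).
  move=> b0 u; rewrite /aug_diff {1}/cmp_map !linear_sum.
  apply: eq_bigr => x _; rewrite [RHS]linearZ [LHS]linearZ; congr (_ *: _).
  rewrite cmpS linearZ /= (boundary_cone (inner_le _ x)) b0 linear0 add0r.
  by rewrite scalerA -exprMn mulrNN mulr1 expr1n scale1r.
elim: i v => [|i IH]; apply: bcmp => x; first exact: boundary_chains0 (inner_le _ x).
by rewrite IH -[@aug_row i.+2 x]aug_diff_delta aug_cx linear0.
Qed.

(* Exactness over Q of the mapping cone of [cmp_map]. *)
Definition cone_exact Q := forall i (x : C i.+1) y, asupp Q x ->
  y \in chains k i.+1 (order_complex Q) -> aug_diff x = 0 ->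
  cmp_map x = \bd y ->
  exists x' : C i.+2, exists y', [/\ asupp Q x',
    y' \in chains k i.+2 (order_complex Q), aug_diff x' = x
    & y = cmp_map x' - \bd y'].

Lemma cone_exact_fill Q i (u : C i.+1) z : cone_exact Q ->
  asupp Q (aug_diff u) -> z \in chains k i (order_complex Q) ->
  \bd z = \bd (cmp_map u) ->
  exists p : C i.+1, exists q, [/\ asupp Q p,
    q \in chains k i.+1 (order_complex Q), aug_diff p = aug_diff u
    & z = cmp_map p - \bd q].
Proof.
case: i u => [|i] u EQ su zQ bz; last first.
  by apply: EQ => //; rewrite ?aug_cx // bz boundary_cmp_map.
exists [ffun=> z set0], 0; split=> //.
- exact: mem0v.
- by apply/ffunP => -[].
rewrite linear0 subr0 /cmp_map (bigD1 tt) //= big1 => [|[]//].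
rewrite ffunE cmp0 addr0 {1}[z]chain_sum (bigD1 set0) //= big1 ?addr0 // => s s0.
apply/eqP; rewrite scaler_eq0; apply/orP; left; apply: contraNT s0.
by move/(chains_neq0 zQ) => [_ /eqP]; rewrite cards_eq0.
Qed.

Lemma cone_exact_le al : cone_exact [set y | (y <= al)%O].
Proof.
move=> i x y sx yQ dx gx; have [w sw dw] := aug_exact sx dx.
have [||z zQ bz] := @cx_le_acyclic k d P i.+1 al (cmp_map w - y).
- rewrite rpredB //; apply: cmp_map_chains => //; exact: down_closed_le.
- by rewrite linearB /= boundary_cmp_map dw gx subrr.
by exists w, z; split=> //; rewrite bz subKr.
Qed.

Lemma cone_exact0 : cone_exact set0.
Proof.
move=> i x y sx yQ dx gx.
have y0 : y = 0.
  apply/ffunP => s; rewrite ffunE; apply/eqP; apply: contraTT isT.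
  move/(chains_neq0 yQ) => [/order_complexP[s0 _]].
  have -> : s = set0 by apply/eqP; rewrite -subset0; apply/subsetP.
  by rewrite cards0.
have -> : x = 0.
  case: i x y yQ sx dx gx y0 => [|i] x y yQ sx dx gx y0; last first.
    apply/ffunP => z; rewrite ffunE; apply/eqP; apply: contraTT isT => /sx.
    by rewrite /= inE.
  move/ffunP: gx => /(_ set0); rewrite y0 linear0 /cmp_map (bigD1 tt) //=.
  rewrite big1 => [|[]//]; rewrite cmp0 !ffunE eqxx addr0 => x0.
  by apply/ffunP => -[]; rewrite ffunE -x0 [_ *: _]mulr1.
exists 0, 0; split; rewrite ?mem0v //; first exact: asupp0.
  exact: linear0.
by rewrite y0 !linear0 ?addr0.
Qed.

(* Mayer-Vietoris for the cover of Q by Q minus a maximal element and the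
   principal ideal of that element. *)
Lemma cone_exact_step Q al : down_closed Q -> al \in Q ->
  (forall y, y \in Q -> (al <= y)%O -> y = al) ->
  cone_exact (Q :\ al) -> cone_exact [set y | (y < al)%O] -> cone_exact Q.
Proof.
move=> dQ alQ almax EQ' Elt i x y sx yQ dx gx.
have leQ : [set y | (y <= al)%O] \subset Q.
  by apply/subsetP => z; rewrite inE; apply: dQ.
have Q'Q : Q :\ al \subset Q by apply: subsetDl.
have ltQ' : [set y | (y < al)%O] \subset Q :\ al.
  apply/subsetP => z; rewrite !inE => zal; rewrite (dQ al) // ?ltW //.
  by rewrite (lt_eqF zal).
have ltle : [set y | (y < al)%O] \subset [set y | (y <= al)%O].
  by apply/subsetP => z; rewrite !inE; apply: ltW.
have Ilt : (Q :\ al) :&: [set y | (y <= al)%O] \subset [set y | (y < al)%O].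
  by apply/subsetP => z; rewrite !inE lt_neqAle => /andP[/andP[-> _] ->].
have dQ' : down_closed (Q :\ al).
  move=> z t; rewrite !inE => /andP[zal zQ] tz; rewrite (dQ z) // andbT.
  by apply: contraNneq zal => tal; rewrite (almax z) // -tal.
pose x1 := arestrict (Q :\ al) x; pose x2 := x - x1.
pose y1 := restrict (order_complex (Q :\ al)) y; pose y2 := y - y1.
have sx1 : asupp (Q :\ al) x1 by apply: arestrict_supp.
have sx2 : asupp [set y | (y <= al)%O] x2.
  apply: arestrictC_supp sx _; apply/subsetP => z zQ; rewrite !inE zQ andbT.
  by have [->|//] := eqVneq z al; rewrite lexx.
have y1Q : y1 \in chains k i.+1 (order_complex (Q :\ al)).
  apply: subvP (restrict_chains _ yQ); apply/chainsS/subsetIl.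
have y2Q : y2 \in chains k i.+1 (cx_le al).
  apply: restrictC_chains yQ _; apply/subsetP => s sQ; rewrite inE.
  have [als|als] := boolP (al \in s); apply/orP; [right|left].
    apply: (order_complex_restrict sQ); apply/subsetP => z zs; rewrite inE.
    have [/(_ z zs) zQ /(_ z al zs als)/orP[//|]] := order_complexP _ _ sQ.
    by move/(almax _ zQ)->.
  apply: (order_complex_restrict sQ); apply/subsetP => z zs; rewrite !inE.
  have [/(_ z zs) -> _] := order_complexP _ _ sQ; rewrite andbT.
  by apply: contraNneq als => <-.
have dx12 : aug_diff x1 = - aug_diff x2.
  by rewrite /x2 linearB /= dx sub0r opprK.
have g12 : cmp_map x1 - \bd y1 = - (cmp_map x2 - \bd y2).
  have -> : cmp_map x2 = \bd y - cmp_map x1 by rewrite linearB /= gx.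
  have -> : \bd y2 = \bd y - \bd y1 by rewrite linearB.
  by rewrite opprB opprB [RHS]addrC addrA subrK.
have [|||p [q [sp qQ dp gp]]] := @cone_exact_fill _ i x1 (cmp_map x1 - \bd y1) Elt.
- apply: asuppS Ilt _; apply: asuppI; first exact: aug_diff_down.
  rewrite dx12; apply/asuppN/aug_diff_down => //; exact: down_closed_le.
- suff Z : cmp_map x1 - \bd y1 \in chains k i
      (order_complex (Q :\ al) :&: cx_le al).
    apply: subvP Z; apply/chainsS/subsetP => s /setIP[s1 s2].
    apply: (order_complex_restrict s1); apply: subset_trans Ilt.
    apply/subsetIP; split; apply/subsetP.
      by case/order_complexP: s1.
    by case/order_complexP: s2.
  apply: chainsI.
    apply: rpredB; first exact: cmp_map_chains.
    exact: boundary_chains (@order_complex_subcomplex _ _ _) y1Q.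
  rewrite g12 rpredN; apply: rpredB.
    by apply: cmp_map_chains sx2; apply: down_closed_le.
  exact: boundary_chains (@order_complex_subcomplex _ _ _) y2Q.
- by rewrite linearB /= (boundary_boundary y1Q) subr0.
have qQ' : q \in chains k i.+1 (order_complex (Q :\ al)).
  by apply: subvP qQ; apply/chainsS/order_complexS.
have qle : q \in chains k i.+1 (cx_le al).
  by apply: subvP qQ; apply/chainsS/order_complexS.
have spQ' := asuppS ltQ' sp; have sple := asuppS ltle sp.
have [||||x1' [y1' [sx1' y1'Q dx1' ey1]]] := EQ' i (x1 - p) (y1 - q).
- exact: asuppB.
- exact: rpredB.
- by rewrite linearB /= dp subrr.
- apply/eqP; rewrite linearB [X in _ == X]linearB /= subr_eq -addrA.
  by rewrite [- _ + _]addrC -gp addrC subrK.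
have [||||x2' [y2' [sx2' y2'Q dx2' ey2]]] :=
    @cone_exact_le al i (x2 + p) (y2 + q).
- exact: asuppD.
- exact: rpredD.
- by rewrite linearD /= dp dx12 subrr.
- apply/eqP; rewrite linearD [X in _ == X]linearD /= -subr_eq0 opprD addrACA.
  by rewrite -gp g12 addrN.
exists (x1' + x2'), (y1' + y2'); split.
- by apply: asuppD; [apply: asuppS sx1'|apply: asuppS sx2'].
- apply: rpredD; [apply: subvP y1'Q|apply: subvP y2'Q]; exact/chainsS/order_complexS.
- by rewrite linearD /= dx1' dx2' addrC addrACA subrr addr0 subrK.
- rewrite linearD (linearD \bd) /= opprD addrACA -ey1 -ey2 addrC addrACA.
  by rewrite subrr addr0 subrK.
Qed.

Lemma down_closed_exact Q : down_closed Q -> cone_exact Q.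
Proof.
have [r] := ubnP #|Q|; elim: r Q => // r IH Q /ltnSE Qr dQ.
have [->|/set0Pn[x0 x0Q]] := eqVneq Q set0; first exact: cone_exact0.
case: (arg_maxnP (fun x => #|[set y | (y <= x)%O]|) x0Q) => al /= alQ almax.
have {}alQ : al \in Q by [].
have {}almax y : y \in Q -> (al <= y)%O -> y = al.
  move=> yQ; rewrite le_eqVlt => /predU1P[//|lt_aly].
  have := almax y yQ; rewrite leqNgt => /negP[]; apply: proper_card.
  apply/properP; split.
    by apply/subsetP => z; rewrite !inE => /le_trans-> //; apply: ltW.
  by exists y; rewrite !inE ?lexx // lt_geF.
have ltr : (#|Q :\ al| < r)%N by move: Qr; rewrite (cardsD1 al) alQ.
have ltQ' : [set y | (y < al)%O] \subset Q :\ al.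
  apply/subsetP => z; rewrite !inE => zal; rewrite (dQ al) // ?ltW //.
  by rewrite (lt_eqF zal).
apply: (cone_exact_step dQ alQ) => //; apply: IH.
- exact: ltr.
- move=> z t; rewrite !inE => /andP[zal zQ] tz; rewrite (dQ z) // andbT.
  by apply: contraNneq zal => tal; rewrite (almax z) // -tal.
- exact: leq_ltn_trans (subset_leq_card ltQ') ltr.
- exact: down_closed_lt.
Qed.

Definition at_level al i (v : {ffun X i -> k^o}) :=
  forall x, v x != 0 -> lev x = al.

Definition level_part al i (v : {ffun X i -> k^o}) : {ffun X i -> k^o} :=
  [ffun x => if lev x == al then v x else 0].

Lemma level_partP al i (v : {ffun X i -> k^o}) : at_level al (level_part al v).
Proof. by move=> x; rewrite ffunE; case: ifP => [/eqP//|]; rewrite eqxx. Qed.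

Lemma at_level_supp al Q i (v : {ffun X i -> k^o}) : at_level al v -> al \in Q ->
  @asupp Q i.+2 v.
Proof. by move=> va alQ x /va/= ->. Qed.

Definition theta al i (v : {ffun X i -> k^o}) : poset_obj k i al :=
  hclass i (cx_lt al) (cmp_map (@aug_diff i.+1 v)).

Fact theta_is_linear al i : linear (@theta al i).
Proof. by move=> b u v; rewrite /theta !linearP. Qed.
HB.instance Definition _ al i :=
  GRing.isLinear.Build k {ffun X i -> k^o} (poset_obj k i al) *:%R
    (@theta al i) (@theta_is_linear al i).

Lemma cmp_map_cycle al i (v : C i.+2) : asupp [set y | (y <= al)%O] v ->
  cmp_map (aug_diff v) \in cycles k i (cx_lt al).
Proof.
move=> sv.
have vD : cmp_map (aug_diff v) \in chains k i (cx_lt al).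
  by apply: cmp_map_chains; [apply: down_closed_lt|apply: aug_diff_lt].
apply/cyclesP; split=> //; case: i v sv vD => [|i] v sv vD.
  exact: boundary_chains0 vD.
by rewrite boundary_cmp_map aug_cx linear0.
Qed.

Lemma theta_inj al i (v : {ffun X i -> k^o}) :
  at_level al v -> theta al v = 0 -> v = 0.
Proof.
move=> va; have sv := at_level_supp va (_ : al \in [set y | (y <= al)%O]).
have {}sv : @asupp [set y | (y <= al)%O] i.+2 v by apply: sv; rewrite inE.
move/(hclass_eq0 (cmp_map_cycle sv))/boundariesP => [y yD gy].
have [||x' [_ [sx' _ dx' _]]] := down_closed_exact (@down_closed_lt al) _ yD _ gy.
- exact: aug_diff_lt.
- exact: aug_cx.
have sx'le : asupp [set y | (y <= al)%O] x'.
  by apply: asuppS _ sx'; apply/subsetP => z; rewrite !inE; apply: ltW.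
have [||w sw dw] := @aug_exact al i.+1 (v - x').
- exact: asuppB.
- by rewrite linearB /= dx' subrr.
have svlt : @asupp [set y | (y < al)%O] i.+2 v.
  rewrite -(subrK x' v) -dw; apply: asuppD => //; exact: aug_diff_lt.
apply/ffunP => x; rewrite ffunE; apply/eqP; apply: contraTT isT => vx.
by have := svlt x vx; rewrite /= inE (va x vx) ltxx.
Qed.

Lemma theta_surj al i (h : poset_obj k i al) :
  exists v : {ffun X i -> k^o}, at_level al v /\ theta al v = h.
Proof.
have /cyclesP[cD bc] := hrepr_cycle h.
have [||p [q [sp qD dp cE]]] :=
    @cone_exact_fill _ i 0 _ (down_closed_exact (@down_closed_lt al)) _ cD _.
- by rewrite linear0; apply: asupp0.
- by rewrite linear0 bc linear0.
have sple : asupp [set y | (y <= al)%O] p.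
  by apply: asuppS _ sp; apply/subsetP => z; rewrite !inE; apply: ltW.
have [|w sw dw] := aug_exact sple; first by rewrite dp linear0.
pose w1 := level_part al (w : {ffun X i -> k^o}).
exists w1; split; first exact: level_partP.
rewrite -(hreprK h); apply: hclass_congr.
have sw2 : @asupp [set y | (y < al)%O] i.+2 (w - w1).
  move=> x; rewrite /w1 !ffunE; case: ifP => [_|/negbT nx].
    by rewrite subrr eqxx.
  by rewrite subr0 => /sw; rewrite /= !inE lt_neqAle nx.
apply/boundariesP; exists (q - cmp_map (w - w1)).
  apply: rpredB => //; apply: cmp_map_chains => //; exact: down_closed_lt.
have -> : \bd (q - cmp_map (w - w1)) =
    \bd q - (cmp_map (aug_diff w) - cmp_map (@aug_diff i.+1 w1)).
  rewrite [LHS]linearB /= boundary_cmp_map; congr (_ - _).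
  by rewrite linearB [LHS]linearB.
by rewrite cE -dw !opprB addrCA.
Qed.

Lemma theta_poset_map al l i (v : {ffun X i.+1 -> k^o}) :
  (forall j (x : X j.+1) y, a x y != 0 -> covers (lev y) (lev x)) ->
  covers l al -> at_level al v ->
  poset_map l (theta al v) =
    theta l (level_part l (@aug_diff i.+2 v : {ffun X i -> k^o})).
Proof.
move=> a_cover la va.
set dv : {ffun X i -> k^o} := @aug_diff i.+2 v.
have sv : @asupp [set y | (y <= al)%O] i.+3 v.
  by apply: at_level_supp va _; rewrite inE.
rewrite /theta -(@boundary_cmp_map i (level_part l dv)).
have down1 b : down_closed [set y | (y <= b)%O] by apply: down_closed_le.
apply: (poset_map_hclass (c'' := @cmp_map i.+1 (dv - level_part l dv))) => //.
- exact: (@cmp_map_cycle al i.+1).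
- apply: cmp_map_chains => //.
  by apply: at_level_supp (@level_partP l i dv) _; rewrite inE.
- apply: memv_suml => y _.
  have [->|] := eqVneq ((dv - level_part l dv) y) 0.
    by rewrite scale0r mem0v.
  rewrite !ffunE; case: ifP => [_|/negbT nyl]; first by rewrite subrr eqxx.
  rewrite subr0 => /aug_diff_neq0[x vx /= axy]; apply: memvZ.
  have cov : covers (lev y) al by rewrite -(va x vx); apply: a_cover axy.
  have -> : cmp y = @cmp_map i.+1 [ffun z => (z == y)%:R].
    rewrite /cmp_map (bigD1 y) //= ffunE eqxx scale1r big1 ?addr0 // => z zy.
    by rewrite ffunE (negbTE zy) scale0r.
  apply: subvP (cmp_map_chains (down1 (lev y)) _).
    apply: chainsS; apply/subsetP => s sy; rewrite in_setU; apply/orP; right.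
    by apply/bigcupP; exists (lev y) => //; rewrite cov.
  move=> z; rewrite ffunE; have [->|] := eqVneq z y; rewrite ?eqxx //=.
  by rewrite inE.
- by rewrite linearB /= addrC subrK.
Qed.

Notation H i := {al : P & 'I_(\dim {:poset_obj k i al})}.
Notation Ht i j := (Tagged (fun al : P => 'I_(\dim {:poset_obj k i al})) j).
Notation Hvec u := ((vbasis {:poset_obj k _ (tag u)})`_(tagged u)).

Fact theta_lift_exists i (u : H i) : exists v : {ffun X i -> k^o},
  [forall x, (v x != 0) ==> (lev x == tag u)] && (theta (tag u) v == Hvec u).
Proof.
have [v [va <-]] := @theta_surj (tag u) i (Hvec u); exists v; rewrite eqxx andbT.
by apply/forallP => x; apply/implyP => /va->.
Qed.

Definition theta_lift i (u : H i) := xchoose (theta_lift_exists u).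

Lemma theta_lift_level i (u : H i) : at_level (tag u) (theta_lift u).
Proof.
have /andP[/forallP/(_ _)/implyP ul _] := xchooseP (theta_lift_exists u).
by move=> x /ul/eqP.
Qed.

Lemma theta_liftK i (u : H i) : theta (tag u) (theta_lift u) = Hvec u.
Proof. by have /andP[_ /eqP] := xchooseP (theta_lift_exists u). Qed.

Lemma theta_lift_expand al i (v : {ffun X i -> k^o}) : at_level al v ->
  v = \sum_(j < \dim {:poset_obj k i al})
        coord (vbasis _) j (theta al v) *: theta_lift (Ht i j).
Proof.
move=> va; apply/eqP; rewrite -subr_eq0; apply/eqP; apply: (@theta_inj al).
  move=> x; apply: contraNeq => nx; rewrite !ffunE sum_ffunE big1 ?subr0.
    by apply: contraNT nx => /va->.
  move=> j _; rewrite ffunE; apply/eqP; rewrite scaler_eq0; apply/orP; right.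
  by apply: contraNT nx => /theta_lift_level->.
rewrite linearB linear_sum /= {1}(coord_vbasis (memvf (theta al v))).
apply/eqP; rewrite subr_eq0; apply/eqP/eq_bigr => j _; rewrite linearZ /=.
by rewrite (theta_liftK (Ht i j)).
Qed.

Definition theta_coef i (x : X i) (u : H i) : k :=
  if lev x == tag u then
    coord (vbasis _) (tagged u) (theta (tag u) [ffun y => (y == x)%:R])
  else 0.

Lemma delta_level i (x : X i) : at_level (lev x) [ffun y => (y == x)%:R : k^o].
Proof. by move=> y; rewrite ffunE; have [->|] := eqVneq y x; rewrite ?eqxx. Qed.

Lemma sum_over_level i al (G : H i -> k) : (forall u, tag u != al -> G u = 0) ->
  \sum_u G u = \sum_(j < \dim {:poset_obj k i al}) G (Ht i j).
Proof.
move=> G0; rewrite (bigID (fun u => tag u == al)) /= addrC big1 ?add0r //.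
transitivity (\sum_(b | b == al) \sum_j G (Ht i (j : 'I_(\dim {:poset_obj k i b}))));
  last by rewrite big_pred1_eq.
by rewrite sig_big_dep; apply: eq_big => [u|[b j] _]; rewrite ?andbT.
Qed.

Lemma ffun_delta_sum i (v : {ffun X i -> k^o}) :
  v = \sum_x v x *: [ffun y => (y == x)%:R].
Proof.
apply/ffunP => y; rewrite sum_ffunE (bigD1 y) //= big1 ?addr0 => [|x xy].
  by rewrite !ffunE eqxx [_ *: _]mulr1.
by rewrite !ffunE eq_sym (negbTE xy) scaler0.
Qed.

Lemma theta_lift_coef i (u u' : H i) :
  \sum_x theta_lift u x * theta_coef x u' = (u == u')%:R.
Proof.
have [uu'|nuu'] := eqVneq (tag u) (tag u'); last first.
  rewrite big1 => [|x _].
    by case: (u =P u') nuu' => // ->; rewrite eqxx.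
  rewrite /theta_coef; have [xu'|] := eqVneq (lev x) (tag u'); rewrite ?mulr0 //.
  apply/eqP; rewrite mulf_eq0; apply/orP; left; apply: contraNT nuu'.
  by move/theta_lift_level <-; rewrite xu'.
case: u u' uu' => [al j] [al' j'] /= E; case: _ / E j' => j'.
rewrite -tag_eqE /tag_eq /= eqxx tagged_asE /=.
have <- : coord (vbasis {:poset_obj k i al}) j' (theta al (theta_lift (Ht i j)))
   = (j == j')%:R.
  rewrite (theta_liftK (Ht i j)).
  by rewrite coord_free ?(basis_free (vbasisP _)) // eq_sym.
rewrite [in RHS](ffun_delta_sum (theta_lift (Ht i j))) !linear_sum.
apply: eq_bigr => x _; rewrite !linearZ /theta_coef /=.
have [//|nx] := eqVneq (lev x) al.
have -> : theta_lift (Ht i j) x = 0.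
  by apply: contraNeq nx => /theta_lift_level->.
by rewrite !mul0r.
Qed.

Lemma theta_coef_lift i (x y : X i) :
  \sum_u theta_coef x u * theta_lift u y = (x == y)%:R.
Proof.
rewrite (@sum_over_level i (lev x)) => [|u nxu]; last first.
  by rewrite /theta_coef eq_sym (negbTE nxu) mul0r.
have /ffunP/(_ y) := theta_lift_expand (@delta_level i x).
rewrite ffunE eq_sym sum_ffunE => ->; apply: eq_bigr => j _.
by rewrite /theta_coef /= eqxx ffunE.
Qed.

Lemma theta_lift_comm i (u : H i.+1) (y : X i) :
  (forall j (x : X j.+1) z, a x z != 0 -> covers (lev z) (lev x)) ->
  \sum_(v : H i) (if covers (tag v) (tag u) then
      coord (vbasis _) (tagged v) (poset_map (tag v) (Hvec u)) else 0) *
      theta_lift v y =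
  \sum_x theta_lift u x * a x y.
Proof.
move=> a_cover; rewrite (@sum_over_level i (lev y)) => [|v nyv]; last first.
  apply/eqP; rewrite mulf_eq0; apply/orP; right; apply: contraNT nyv.
  by move/theta_lift_level->.
have [cov|ncov] := boolP (covers (lev y) (tag u)); last first.
  rewrite big1 => [|j _]; last by rewrite mul0r.
  rewrite big1 // => x _.
  apply/eqP; rewrite mulf_eq0; apply: contraNT ncov.
  by rewrite negb_or => /andP[/theta_lift_level<- /a_cover].
pose dv : {ffun X i -> k^o} := @aug_diff i.+2 (theta_lift u).
have /ffunP/(_ y) := theta_lift_expand (@level_partP (lev y) i dv).
rewrite ffunE eqxx sum_ffunE => /esym; rewrite sum_ffunE => e1.
transitivity (\sum_x (theta_lift u x *: @aug_row i.+2 x) y); last first.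
  by apply: eq_bigr => x _; rewrite !ffunE.
rewrite -e1; apply: eq_bigr => j _; rewrite ffunE /= -theta_liftK.
by rewrite (theta_poset_map a_cover cov (@theta_lift_level _ u)).
Qed.

End Comparison.

Section HomogeneousCoefficients.
Variables (k : fieldType) (n : nat).
Implicit Types (z w : zdeg n) (p q : {mpoly k[n]}).

Lemma zdegP z w : reflect (forall j, z j <= w j) (z <= w)%O.
Proof. exact: forallP. Qed.

Definition nneg z := [forall j, 0 <= z j].

Lemma nnegP z : reflect (forall j, 0 <= z j) (nneg z).
Proof. exact: forallP. Qed.

Lemma zdeg_subr_ge0 z w : nneg (w - z) = (z <= w)%O.
Proof.
by apply/nnegP/zdegP => zw j; have := zw j; rewrite !ffunE subr_ge0.
Qed.

Lemma nneg_le z w : nneg z -> (z <= w)%O -> nneg w.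
Proof. by move=> /nnegP z0 /zdegP zw; apply/nnegP => j; apply: le_trans (zw j). Qed.

Definition zmnm z : 'X_{1..n} := [multinom `|z j|%N | j < n].

Lemma zmnmD z w : nneg z -> nneg w ->
  zmnm (z + w) = (zmnm z + zmnm w)%MM.
Proof.
move=> /nnegP z0 /nnegP w0; apply/mnmP => j; rewrite mnmDE !mnmE !ffunE.
have := z0 j; have := w0 j.
by case: (z j) (w j) => [a|//] [b|//].
Qed.

Lemma zmonD z w : nneg z -> nneg w ->
  zmon k (z + w) = zmon k z * zmon k w.
Proof. by move=> z0 w0; rewrite /zmon -mpolyXD -zmnmD. Qed.

Lemma zmon_neq0 z : zmon k z != 0.
Proof. by rewrite -msupp_eq0 msuppX. Qed.

(* The coefficient of x^z, which is 0 when z has a negative entry. *)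
Definition coefz z p : k^o := if nneg z then p@_(zmnm z) else 0.

Fact coefz_is_linear z : linear (coefz z).
Proof.
move=> c p q; rewrite /coefz; case: ifP => _; last by rewrite scaler0 addr0.
by rewrite mcoeffD mcoeffZ.
Qed.
HB.instance Definition _ z :=
  GRing.isLinear.Build k {mpoly k[n]} k^o *:%R (coefz z) (coefz_is_linear z).

Lemma coefz_neq0 z p : coefz z p != 0 -> nneg z.
Proof. by rewrite /coefz; case: ifP => //; rewrite eqxx. Qed.

Lemma coefz_zmon z : nneg z -> coefz z (zmon k z) = 1.
Proof. by move=> z0; rewrite /coefz z0 mcoeffX eqxx. Qed.

Lemma coefzM_zmon z w p : nneg w ->
  coefz z (p * zmon k w) = coefz (z - w) p.
Proof.
move=> w0; rewrite /coefz zdeg_subr_ge0.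
have [wz|nwz] := boolP (w <= z)%O.
  have -> : zmnm z = mnm_add (zmnm w) (zmnm (z - w)).
    by rewrite -zmnmD ?zdeg_subr_ge0 // addrC subrK.
  by rewrite (nneg_le w0 wz) -(mcoeffMX p (zmnm w)).
case: ifP => // z0; apply/eqP; rewrite mcoeff_eq0; apply: contra nwz.
move=> /msuppM_le/allpairsP[[u v] /= [_]]; rewrite msuppX inE => /eqP -> e.
apply/zdegP => j; move/mnmP: e => /(_ j); rewrite mnmDE !mnmE.
have /nnegP/(_ j) := z0; have /nnegP/(_ j) := w0.
by case: (w j) => // a; case: (z j) => // b _ _ /= ->; rewrite lez_nat leq_addl.
Qed.

Lemma mhomogE z p : mhomog z p -> p = coefz z p *: zmon k z.
Proof.
move=> hp; apply/mpolyP => u; rewrite mcoeffZ mcoeffX /coefz -/(zmnm z).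
have mz : u \in msupp p -> nneg z && (zmnm z == u).
  move=> /hp uz; apply/andP; split.
    by apply/nnegP => j; rewrite -uz.
  by apply/eqP/mnmP => j; rewrite mnmE -uz.
have [/mz/andP[-> /eqP->]|up] := boolP (u \in msupp p).
  by rewrite eqxx mulr1.
have /eqP -> : p@_u == 0 by rewrite mcoeff_eq0.
case: ifP => _; last by rewrite mul0r.
case: eqP => [->|_]; last by rewrite mulr0.
by rewrite mulr1; apply/esym/eqP; rewrite mcoeff_eq0.
Qed.

Lemma mhomog_ge0 z p : mhomog z p -> p != 0 -> nneg z.
Proof.
move=> /mhomogE pE p0; apply: (@coefz_neq0 z p).
by apply: contraNneq p0 => c0; rewrite pE c0 scale0r.
Qed.

Lemma mhomog_le z w p : mhomog (w - z) p -> p != 0 -> (z <= w)%O.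
Proof. by move=> hp /(mhomog_ge0 hp); rewrite zdeg_subr_ge0. Qed.

Lemma mhomog0 z : mhomog z (0 : {mpoly k[n]}).
Proof. by move=> u; rewrite msupp0. Qed.

Lemma mhomog_const z p : mhomog z p -> p@_0%MM != 0 -> z = 0.
Proof.
rewrite -mcoeff_msupp => hp /hp z0; apply/ffunP => j; rewrite ffunE -z0.
by rewrite mnm0E.
Qed.

Lemma mhomog_const_neq0 z p : mhomog z p -> p != 0 -> p@_0%MM = 0 -> z != 0.
Proof.
move=> hp p0 c0; apply: contraNneq p0 => z0; rewrite (mhomogE hp) /coefz z0.
have -> : zmnm 0 = 0%MM by apply/mnmP => j; rewrite mnmE mnm0E ffunE.
by rewrite c0; case: ifP; rewrite scale0r.
Qed.

Definition hpart z p : {mpoly k[n]} := coefz z p *: zmon k z.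

Lemma hpart_mhomog z p : mhomog z (hpart z p).
Proof.
rewrite /hpart; have [->|/coefz_neq0/nnegP z0] := eqVneq (coefz z p) 0.
  by rewrite scale0r; apply: mhomog0.
by apply/mhomogZ/mhomog_zmon => j; apply: z0.
Qed.

Fact hpart_is_linear z : linear (hpart z).
Proof. by move=> c p q; rewrite /hpart linearP scalerDl scalerA. Qed.
HB.instance Definition _ z :=
  GRing.isLinear.Build k {mpoly k[n]} {mpoly k[n]} *:%R (hpart z)
    (hpart_is_linear z).

Lemma hpartM z w p q : mhomog w q -> hpart z (p * q) = hpart (z - w) p * q.
Proof.
move=> hq; have [->|q0] := eqVneq q 0; first by rewrite !mulr0 linear0.
have w0 := mhomog_ge0 hq q0; rewrite (mhomogE hq) -!scalerAr linearZ /=.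
congr (_ *: _); rewrite /hpart coefzM_zmon // -scalerAl.
have [->|/coefz_neq0 zw] := eqVneq (coefz (z - w) p) 0.
  by rewrite !scale0r.
by rewrite -zmonD // subrK.
Qed.

End HomogeneousCoefficients.

Section HomogeneousBasis.
Variables (k : fieldType) (n : nat) (X T : gfree n).
Variables (b : T -> gcarrier k n X) (b_basis : homog_basis b).
Notation R := {mpoly k[n]}.

Fact bcoord_exists v : exists c : {ffun T -> R}, v == \sum_t c t *: b t.
Proof. by have [c [vc _]] := b_basis.2 v; exists c; apply/eqP. Qed.

Definition bcoord (v : gcarrier k n X) : gcarrier k n T :=
  xchoose (bcoord_exists v).

Lemma bcoordK v : \sum_t (bcoord v t : R) *: b t = v.
Proof. by apply/esym/eqP/(xchooseP (bcoord_exists v)). Qed.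

Lemma bcoord_uniq v (c : T -> R) : v = \sum_t c t *: b t ->
  bcoord v = [ffun t => c t].
Proof.
move=> vc; have [c0 [_ c0U]] := b_basis.2 v.
rewrite -[LHS]c0U; last by rewrite bcoordK.
by apply: c0U; rewrite vc; apply: eq_bigr => t _; rewrite ffunE.
Qed.

Fact bcoord_is_linear : linear bcoord.
Proof.
move=> a u v; rewrite (@bcoord_uniq _ (fun t => a * bcoord u t + bcoord v t)).
  by apply/ffunP => t; rewrite !ffunE.
rewrite -{1}(bcoordK u) -{1}(bcoordK v) scaler_sumr -big_split /=.
by apply: eq_bigr => t _; rewrite scalerDl scalerA.
Qed.
HB.instance Definition _ :=
  GRing.isLinear.Build R (gcarrier k n X) (gcarrier k n T) *:%R bcoord
    bcoord_is_linear.

Lemma bcoord_sum (c : T -> R) :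
  bcoord (\sum_t c t *: b t) = [ffun t => c t].
Proof. exact: bcoord_uniq. Qed.

Lemma bcoord_basis t : bcoord (b t) = [ffun s => (s == t)%:R].
Proof.
apply: bcoord_uniq; rewrite (bigD1 t) //= eqxx scale1r big1 ?addr0 // => s st.
by rewrite (negbTE st) scale0r.
Qed.

Lemma bcoord_mhomog g v t : ghomog g v -> mhomog (g - gdeg t) (bcoord v t : R).
Proof.
move=> hv.
rewrite (@bcoord_uniq v (fun t => hpart (g - gdeg t) (bcoord v t))).
  by rewrite ffunE; apply: hpart_mhomog.
apply/ffunP => x; rewrite sum_ffunE.
transitivity (hpart (g - gdeg x) (v x)); first exact: mhomogE (hv x).
rewrite -{1}(bcoordK v) sum_ffunE linear_sum /=.
apply: eq_bigr => s _; rewrite !ffunE.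
rewrite (hpartM _ _ (b_basis.1 s x)); congr (hpart _ _ * _).
by rewrite opprB addrA subrK.
Qed.

Definition gdelta (x : X) : gcarrier k n X := [ffun y => (y == x)%:R].

Lemma gdelta_sum (v : gcarrier k n X) : v = \sum_x (v x : R) *: gdelta x.
Proof.
apply/ffunP => y; rewrite sum_ffunE (bigD1 y) //= big1 ?addr0 => [|x xy].
  by rewrite !ffunE eqxx [_ *: _]mulr1.
by rewrite !ffunE eq_sym (negbTE xy) scaler0.
Qed.

Lemma gdelta_homog x : ghomog (gdeg x) (gdelta x).
Proof.
move=> y; rewrite ffunE; have [->|_] := eqVneq y x; last exact: mhomog0.
rewrite subrr => u; rewrite msupp1 inE => /eqP-> j.
by rewrite mnm0E ffunE.
Qed.

(* Comparing constant coefficients in [b t = \sum_x (b t) x *: gdelta x]. *)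
Lemma homog_basis_deg (t : T) : exists x : X, gdeg x = gdeg (t : T).
Proof.
have : (bcoord (b t) t : R)@_0%MM != 0.
  by rewrite bcoord_basis ffunE eqxx mcoeff1 eqxx oner_neq0.
rewrite (gdelta_sum (b t)) linear_sum sum_ffunE raddf_sum /=.
have [x bx|b0] := pickP (fun x => (b t x : R)@_0%MM != 0).
  exists x; apply/eqP; rewrite eq_sym -subr_eq0; apply/eqP.
  exact: mhomog_const (b_basis.1 t x) bx.
rewrite big1 ?eqxx // => x _; rewrite linearZ ffunE.
have /negbFE/eqP bx0 := b0 x.
by rewrite [LHS](rmorphM (mcoeff 0%MM)) /= [X in X * _]bx0 mul0r.
Qed.

End HomogeneousBasis.

Section ResolutionDegrees.
Variables (k : fieldType) (n : nat) (I : {mpoly k[n]} -> Prop).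
Variables (F : gseq k n) (m : nat) (F_res : minimal_resolution I F m).
Notation R := {mpoly k[n]}.

Lemma gdelta_not_boundary i (x : F i) w : gdiff F i w <> gdelta k x.
Proof.
move=> e; have := mr_minimal F_res w x; rewrite e ffunE eqxx mcoeff1 eqxx.
exact/eqP/oner_neq0.
Qed.

Lemma gdiff_gdelta_neq0 i (x : F i.+1) :
  exists y : F i, gdiff F i (gdelta k x) y != 0.
Proof.
apply/existsP; apply: contraT; rewrite negb_exists => /forallP d0.
have /(mr_exact F_res)[w /gdelta_not_boundary//] : gdiff F i (gdelta k x) = 0.
by apply/ffunP => y; rewrite ffunE; apply/eqP; have := d0 y; rewrite negbK.
Qed.

Lemma gdiff_gdelta_mhomog i (x : F i.+1) (y : F i) :
  mhomog (gdeg x - gdeg y) (gdiff F i (gdelta k x) y : R).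
Proof. by apply: gdiffP; apply: gdelta_homog. Qed.

Lemma gdiff_gdelta_lt i (x : F i.+1) (y : F i) :
  gdiff F i (gdelta k x) y != 0 -> (gdeg y < gdeg x)%O.
Proof.
move=> xy; have hxy := @gdiff_gdelta_mhomog i x y.
rewrite lt_neqAle (mhomog_le hxy xy) andbT eq_sym -subr_eq0.
apply: mhomog_const_neq0 hxy xy _; exact: (mr_minimal F_res).
Qed.

Lemma betti_degs_bound i (x : F i) : gdeg x \in betti_degs F m.
Proof.
apply/flatten_mapP; exists i; last by apply: image_f.
rewrite mem_iota add0n ltnS /= leqNgt; apply/negP => /(mr_length F_res) F0.
by have := max_card (pred1 x); rewrite card1 F0.
Qed.

Lemma generator_below i (x : F i) : exists y : F 0%N, (gdeg y <= gdeg x)%O.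
Proof.
elim: i x => [|i IH] x; first by exists x.
have [y /gdiff_gdelta_lt/ltW yx] := gdiff_gdelta_neq0 x.
by have [z zy] := IH y; exists z; apply: le_trans yx.
Qed.

Variable eps : {linear gcarrier k n (F 0%N) -> R^o}.
Hypothesis eps_homog : forall g v, ghomog g v -> mhomog g (eps v).
Hypothesis eps_ker : forall v, eps v = 0 <-> exists w, gdiff F 0%N w = v.

Lemma betti_monomial i (x : F i) :
  nneg (gdeg x) /\ exists v, eps v = zmon k (gdeg x).
Proof.
have [y yx] := generator_below x.
have ey : eps (gdelta k y) != 0.
  by apply/eqP => /eps_ker[w /gdelta_not_boundary].
have hy := eps_homog (@gdelta_homog k n _ y).
have y0 := mhomog_ge0 hy ey; split; first exact: nneg_le yx.
set c := coefz (gdeg y) (eps (gdelta k y)).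
have c0 : c != 0 by apply: contraNneq ey => c0; rewrite (mhomogE hy) -/c c0 scale0r.
exists ((c^-1 *: zmon k (gdeg x - gdeg y) : R) *: gdelta k y).
transitivity ((c^-1 *: zmon k (gdeg x - gdeg y)) * (c *: zmon k (gdeg y))).
  by rewrite linearZ /= {1}(mhomogE hy).
rewrite -scalerAl -scalerAr scalerA.
by rewrite mulVf // scale1r -zmonD ?zdeg_subr_ge0 // subrK.
Qed.

End ResolutionDegrees.

Fact regular_scaleAr (k : fieldType) n (p q : {mpoly k[n]}) (c : k) :
  p *: (c *: q : {mpoly k[n]}^o) = c *: (p * q) :> {mpoly k[n]}.
Proof. by rewrite [LHS]/(p * (c *: q)) scalerAr. Qed.

Section Dehomogenization.
Variables (k : fieldType) (n : nat) (I : {mpoly k[n]} -> Prop).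
Variables (F : gseq k n) (m : nat) (F_res : minimal_resolution I F m).
Notation R := {mpoly k[n]}.
Variable eps : {linear gcarrier k n (F 0%N) -> R^o}.
Hypothesis eps_homog : forall g v, ghomog g v -> mhomog g (eps v).
Hypothesis eps_ker : forall v, eps v = 0 <-> exists w, gdiff F 0%N w = v.
Variables (T : nat -> gfree n) (b : forall t, T t -> gcarrier k n (F t)).
Hypothesis b_basis : forall t, homog_basis (@b t).

Fact basis_betti_degs i (t : T i) : gdeg t \in betti_degs F m.
Proof.
by have [x <-] := homog_basis_deg (b_basis i) t; apply: (betti_degs_bound F_res).
Qed.

Definition lev i (t : T i) : betti_poset F m := SeqSub (basis_betti_degs t).

Definition scalar_mx i (t : T i.+1) (s : T i) : k :=
  coefz (gdeg t - gdeg s) (bcoord (b_basis i) (gdiff F i (b t)) s).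

Definition scalar_eps (t : T 0%N) : k := coefz (gdeg t) (eps (b t)).

Lemma scalar_mxE i (t : T i.+1) (s : T i) :
  bcoord (b_basis i) (gdiff F i (b t)) s =
    scalar_mx t s *: zmon k (gdeg t - gdeg s).
Proof. by apply/mhomogE/bcoord_mhomog/gdiffP; apply: (b_basis _).1. Qed.

Lemma scalar_epsE (t : T 0%N) : eps (b t) = scalar_eps t *: zmon k (gdeg t).
Proof. by apply/mhomogE/eps_homog; apply: (b_basis _).1. Qed.

Lemma scalar_mx_nneg i (t : T i.+1) (s : T i) :
  scalar_mx t s != 0 -> nneg (gdeg t - gdeg s).
Proof. exact: coefz_neq0. Qed.

Lemma gdiff_basis i (t : T i.+1) :
  gdiff F i (b t) = \sum_s (scalar_mx t s *: zmon k (gdeg t - gdeg s)) *: b s.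
Proof.
rewrite -[LHS](bcoordK (b_basis i)).
by apply: eq_bigr => s _; rewrite scalar_mxE.
Qed.

Notation D := (aug_diff scalar_mx scalar_eps).

Definition hz (al : zdeg n) i (v : {ffun T i -> k^o}) : gcarrier k n (F i) :=
  \sum_t (v t *: zmon k (al - gdeg t)) *: b t.

Definition cz (al : zdeg n) i (v : gcarrier k n (F i)) : {ffun T i -> k^o} :=
  [ffun t => coefz (al - gdeg t) (bcoord (b_basis i) v t)].

Lemma cz_le al i (v : gcarrier k n (F i)) t :
  cz al v t != 0 -> (gdeg t <= al)%O.
Proof. by rewrite ffunE => /coefz_neq0; rewrite zdeg_subr_ge0. Qed.

Lemma cz_hz al i (v : {ffun T i -> k^o}) :
  (forall t, v t != 0 -> (gdeg t <= al)%O) -> cz al (hz al v) = v.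
Proof.
move=> sv; apply/ffunP => t; rewrite ffunE bcoord_sum ffunE linearZ /=.
have [->|/sv t_al] := eqVneq (v t) 0; first by rewrite scale0r.
by rewrite coefz_zmon ?zdeg_subr_ge0 // [_ *: _]mulr1.
Qed.

Lemma cz_gdiff al i (w : gcarrier k n (F i.+1)) :
  cz al (gdiff F i w) = D (cz al w : {ffun aug_idx T i.+3 -> k^o}).
Proof.
apply/ffunP => s; rewrite ffunE sum_ffunE -{1}(bcoordK (b_basis i.+1) w).
rewrite !linear_sum sum_ffunE linear_sum /=; apply: eq_bigr => t _.
rewrite !linearZ /= !ffunE scalar_mxE regular_scaleAr linearZ /=.
have [->|/scalar_mx_nneg ts] := eqVneq (scalar_mx t s) 0.
  by rewrite scale0r scaler0.
rewrite coefzM_zmon // opprB addrA subrK; exact: mulrC.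
Qed.

Lemma gdiff_hz al i (v : {ffun T i.+1 -> k^o}) :
  (forall t, v t != 0 -> (gdeg t <= al)%O) ->
  gdiff F i (hz al v) = hz al (D (v : {ffun aug_idx T i.+3 -> k^o}) :
    {ffun T i -> k^o}).
Proof.
move=> sv; rewrite /hz linear_sum /=.
transitivity (\sum_t \sum_s ((v t * scalar_mx t s) *: zmon k (al - gdeg s)) *: b s).
  apply: eq_bigr => t _; rewrite linearZ /= gdiff_basis scaler_sumr.
  apply: eq_bigr => s _; rewrite scalerA; congr (_ *: _).
  rewrite -scalerAl -scalerAr scalerA.
  have [->|/scalar_mx_nneg ts] := eqVneq (scalar_mx t s) 0.
    by rewrite mulr0 !scale0r.
  have [->|/sv t_al] := eqVneq (v t) 0; first by rewrite mul0r !scale0r.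
  by rewrite -zmonD // ?zdeg_subr_ge0 // addrA subrK.
rewrite exchange_big /=; apply: eq_bigr => s _; rewrite -scaler_suml.
congr (_ *: _); rewrite sum_ffunE scaler_suml; apply: eq_bigr => t _.
by rewrite !ffunE.
Qed.

Lemma cz_eps al (w : gcarrier k n (F 0%N)) :
  \sum_t cz al w t * scalar_eps t = coefz al (eps w).
Proof.
rewrite -{2}(bcoordK (b_basis 0) w) !linear_sum /=; apply: eq_bigr => t _.
rewrite linearZ /= scalar_epsE regular_scaleAr linearZ /= ffunE.
have [->|/coefz_neq0 t0] := eqVneq (scalar_eps t) 0.
  by rewrite mulr0 scale0r.
by rewrite coefzM_zmon // mulrC.
Qed.

Lemma eps_hz al (v : {ffun T 0%N -> k^o}) :
  (forall t, v t != 0 -> (gdeg t <= al)%O) ->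
  eps (hz al v) = (\sum_t v t * scalar_eps t) *: zmon k al.
Proof.
move=> sv; rewrite /hz linear_sum scaler_suml /=; apply: eq_bigr => t _.
rewrite linearZ /= scalar_epsE.
transitivity ((v t *: zmon k (al - gdeg t)) * (scalar_eps t *: zmon k (gdeg t))) => //.
rewrite -scalerAl -scalerAr scalerA.
have [->|/coefz_neq0 t0] := eqVneq (scalar_eps t) 0.
  by rewrite mulr0 !scale0r.
have [->|/sv t_al] := eqVneq (v t) 0; first by rewrite mul0r !scale0r.
by rewrite -zmonD // ?zdeg_subr_ge0 // subrK.
Qed.

Lemma asupp_le (al : betti_poset F m) i (v : {ffun T i -> k^o}) :
  @asupp k _ _ T lev [set y | (y <= al)%O] i.+2 v <->
  forall t, v t != 0 -> (gdeg t <= betti_incl al)%O.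
Proof. by split=> sv t /sv; rewrite /= inE. Qed.

Lemma scalar_exact (al : betti_poset F m) i (v : {ffun aug_idx T i.+1 -> k^o}) :
  asupp lev [set y | (y <= al)%O] v -> D v = 0 ->
  exists2 w : {ffun aug_idx T i.+2 -> k^o},
    asupp lev [set y | (y <= al)%O] w & D w = v.
Proof.
have /flatten_mapP[j _ /imageP[x _ alx]] := valP al.
have [al0 [f ef]] := betti_monomial F_res eps_homog eps_ker x.
case: i v => [|[|i]] v sv dv.
- exists (v tt *: cz (betti_incl al) f).
    apply/asupp_le => t; rewrite ffunE scaler_eq0 negb_or => /andP[_].
    exact: cz_le.
  apply/ffunP => -[]; rewrite linearZ ffunE sum_ffunE /=.
  rewrite (eq_bigr (fun t => cz (betti_incl al) f t * scalar_eps t)).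
    by rewrite cz_eps /betti_incl alx ef coefz_zmon // [_ *: _]mulr1.
  by move=> t _; rewrite !ffunE.
- have {}sv := (asupp_le _ _).1 sv.
  have /eps_ker[w ew] : eps (hz (betti_incl al) (v : {ffun T 0%N -> k^o})) = 0.
    rewrite eps_hz //; move/ffunP: dv => /(_ tt); rewrite sum_ffunE ffunE.
    rewrite (eq_bigr (fun t => v t * scalar_eps t)) => [->|t _].
      by rewrite scale0r.
    by rewrite !ffunE.
  exists (cz (betti_incl al) w); first by apply/asupp_le => t /cz_le.
  by rewrite -cz_gdiff ew cz_hz.
- have {}sv := (asupp_le _ _).1 sv.
  have /(mr_exact F_res)[w ew] :
      gdiff F i (hz (betti_incl al) (v : {ffun T i.+1 -> k^o})) = 0.
    rewrite gdiff_hz // dv /hz big1 // => s _.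
    by rewrite ffunE !scale0r.
  exists (cz (betti_incl al) w); first by apply/asupp_le => t /cz_le.
  by rewrite -cz_gdiff ew cz_hz.
Qed.

Lemma scalar_cx i (w : {ffun aug_idx T i.+2 -> k^o}) : D (D w) = 0.
Proof.
suff D0 (t : T i) : D (aug_row scalar_mx scalar_eps (t : aug_idx T i.+2)) = 0.
  rewrite [D w]/aug_diff linear_sum big1 // => t _.
  by rewrite linearZ /= D0 scaler0.
case: i w t => [|i] w t; first by apply/ffunP => -[].
rewrite -aug_diff_delta.
pose v : {ffun T i.+1 -> k^o} := [ffun s => (s == t)%:R].
have vt s : v s != 0 -> (gdeg s <= gdeg t)%O.
  by rewrite ffunE; have [->|] := eqVneq s t; rewrite ?eqxx.
have -> : D (v : {ffun aug_idx T i.+3 -> k^o}) =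
    cz (gdeg t) (gdiff F i (hz (gdeg t) v)) by rewrite cz_gdiff cz_hz.
case: i w t v vt => [|i] w t v vt.
  apply/ffunP => -[]; rewrite sum_ffunE ffunE.
  rewrite (eq_bigr (fun s => cz (gdeg t) (gdiff F 0 (hz (gdeg t) v)) s *
    scalar_eps s)) => [|s _]; last by rewrite !ffunE.
  by rewrite cz_eps (eps_ker _).2 ?linear0 //; exists (hz (gdeg t) v).
rewrite -cz_gdiff (mr_exact F_res _).2; last by exists (hz (gdeg t) v).
by apply/ffunP => s; rewrite !ffunE linear0 ffunE linear0.
Qed.

Hypothesis b_linear : forall i (tau : T i.+1) (c : T i -> {mpoly k[n]}),
  gdiff F i (b tau) = \sum_gamma c gamma *: b gamma ->
  forall gamma, c gamma != 0 -> exists y x : betti_poset F m,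
    [/\ betti_incl y = gdeg gamma, betti_incl x = gdeg tau & covers y x].

Lemma scalar_cover i (t : T i.+1) (s : T i) :
  scalar_mx t s != 0 -> covers (lev s) (lev t).
Proof.
move=> ts; set c := bcoord (b_basis i) (gdiff F i (b t)).
have e : gdiff F i (b t) = \sum_s (c s : R) *: b s by rewrite bcoordK.
have cs : (c s : R) != 0.
  by rewrite /c scalar_mxE -mul_mpolyC mulf_neq0 ?zmon_neq0 // mpolyC_eq0.
have [y [x [ys xt]]] := b_linear e cs.
have -> : lev s = y by apply: val_inj; rewrite /= -ys.
by have -> : lev t = x by apply: val_inj; rewrite /= -xt.
Qed.

Lemma scalar_lt i (t : T i.+1) (s : T i) :
  scalar_mx t s != 0 -> (lev s < lev t)%O.
Proof. by move/scalar_cover; rewrite /covers => /andP[]. Qed.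

Notation Hm := (homogenization k (@betti_incl_homo k n F m)).
Notation lift := (theta_lift scalar_lt scalar_cx scalar_exact).
Notation coef := (theta_coef lev scalar_mx scalar_eps).

Definition iso_map i (w : gcarrier k n (Hm i)) : gcarrier k n (F i) :=
  \sum_u (w u : R) *: \sum_t (lift u t)%:MP *: b t.

Fact iso_map_is_linear i : linear (@iso_map i).
Proof.
move=> c u v; rewrite /iso_map scaler_sumr -big_split /=.
by apply: eq_bigr => x _; rewrite !ffunE scalerDl scalerA.
Qed.
HB.instance Definition _ i :=
  GRing.isLinear.Build R (gcarrier k n (Hm i)) (gcarrier k n (F i)) *:%R
    (@iso_map i) (@iso_map_is_linear i).

Definition iso_inv i (v : gcarrier k n (F i)) : gcarrier k n (Hm i) :=
  [ffun u => \sum_t bcoord (b_basis i) v t * (coef t u)%:MP].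

Lemma iso_mapE i (w : gcarrier k n (Hm i)) :
  iso_map w = \sum_t (\sum_u w u * (lift u t)%:MP : R) *: b t.
Proof.
rewrite /iso_map (eq_bigr (fun u => \sum_t ((w u * (lift u t)%:MP : R) *: b t))).
  by rewrite exchange_big; apply: eq_bigr => t _; rewrite scaler_suml.
by move=> u _; rewrite scaler_sumr; apply: eq_bigr => t _; rewrite scalerA.
Qed.

Lemma iso_map_bij i : bijective (@iso_map i).
Proof.
exists (@iso_inv i) => [w|v].
  apply/ffunP => u; rewrite ffunE iso_mapE bcoord_sum.
  rewrite (eq_bigr (fun t => \sum_u' w u' * (lift u' t * coef t u)%:MP)); last first.
    move=> t _; rewrite ffunE mulr_suml; apply: eq_bigr => u' _.
    by rewrite mpolyCM mulrA.
  rewrite exchange_big (bigD1 u) //= [X in _ + X]big1 => [|u' nu'].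
    rewrite addr0 -mulr_sumr -raddf_sum.
    by rewrite (theta_lift_coef scalar_lt scalar_cx scalar_exact) eqxx mulr1.
  rewrite -mulr_sumr -raddf_sum.
  rewrite (theta_lift_coef scalar_lt scalar_cx scalar_exact) (negbTE nu').
  by rewrite /= mpolyC0 mulr0.
rewrite iso_mapE -[RHS](bcoordK (b_basis i)); apply: eq_bigr => t _.
congr (_ *: _); set c := bcoord _ v.
rewrite (eq_bigr (fun u => \sum_s c s * (coef s u * lift u t)%:MP)); last first.
  move=> u _; rewrite ffunE mulr_suml; apply: eq_bigr => s _.
  by rewrite mpolyCM mulrA.
rewrite exchange_big (bigD1 t) //= [X in _ + X]big1 => [|s ns].
  by rewrite addr0 -mulr_sumr -raddf_sum theta_coef_lift eqxx mulr1.
by rewrite -mulr_sumr -raddf_sum theta_coef_lift (negbTE ns) /= mpolyC0 mulr0.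
Qed.

Lemma lift_gdeg i (u : Hm i) t : lift u t != 0 -> gdeg t = gdeg u.
Proof. by move/theta_lift_level => e; rewrite [RHS]/(betti_incl (tag u)) -e. Qed.

Lemma iso_map_homog i : deg_preserving (@iso_map i).
Proof.
move=> g w hw x; rewrite iso_mapE sum_ffunE; apply: mhomog_sum => t.
rewrite ffunE [_ *: _]mulr_suml; apply: mhomog_sum => u.
have [->|/lift_gdeg tu] := eqVneq (lift u t) 0.
  by rewrite mpolyC0 mulr0 mul0r; apply: mhomog0.
rewrite mulrC mulrA mulrC mul_mpolyC; apply: mhomogZ.
have -> : g - gdeg x = (gdeg t - gdeg x) + (g - gdeg u).
  by rewrite -tu [RHS]addrC addrA subrK.
by apply: mhomogM; [apply: (b_basis i).1 | apply: hw].
Qed.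

Lemma iso_map_gdiff i (w : gcarrier k n (Hm i.+1)) :
  iso_map (gdiff Hm i w) = gdiff F i (iso_map w).
Proof.
rewrite !iso_mapE linear_sum /=.
transitivity (\sum_s (\sum_t (\sum_u w u * (lift u t)%:MP : R) *
    (scalar_mx t s *: zmon k (gdeg t - gdeg s))) *: b s); last first.
  rewrite (eq_bigr (fun s => \sum_t ((\sum_u w u * (lift u t)%:MP : R) *
    (scalar_mx t s *: zmon k (gdeg t - gdeg s))) *: b s)) => [|s _]; last first.
    by rewrite scaler_suml.
  rewrite exchange_big; apply: eq_bigr => t _; rewrite linearZ /= gdiff_basis.
  by rewrite scaler_sumr; apply: eq_bigr => s _; rewrite scalerA.
apply: eq_bigr => s _; congr (_ *: _).
transitivity (\sum_u w u * ((\sum_t lift u t * scalar_mx t s) *: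
    zmon k (gdeg u - gdeg s))); last first.
  rewrite (eq_bigr (fun t => \sum_u w u * ((lift u t * scalar_mx t s) *:
      zmon k (gdeg u - gdeg s)))) => [|t _]; last first.
    rewrite mulr_suml; apply: eq_bigr => u _; rewrite -mulrA mul_mpolyC scalerA.
    have [->|/lift_gdeg ->//] := eqVneq (lift u t) 0.
    by rewrite mul0r !scale0r.
  rewrite exchange_big; apply: eq_bigr => u _.
  by rewrite scaler_suml mulr_sumr.
rewrite (eq_bigr (fun v => \sum_u w u * (hmg_coef u v * (lift v s)%:MP)))
    => [|v _]; last first.
  by rewrite ffunE mulr_suml; apply: eq_bigr => u _; rewrite mulrA.
rewrite exchange_big; apply: eq_bigr => u _; rewrite -mulr_sumr; congr (_ * _).
rewrite -(theta_lift_comm scalar_lt scalar_cx scalar_exact _ _ scalar_cover).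
rewrite scaler_suml; apply: eq_bigr => v _; rewrite /hmg_coef.
case: ifP => _; last by rewrite !mul0r scale0r.
rewrite mulrC mul_mpolyC scalerA mulrC.
have [->|/lift_gdeg ->//] := eqVneq (lift v s) 0.
by rewrite mulr0 !scale0r.
Qed.

Lemma linear_gseq_iso : gseq_iso Hm F.
Proof.
exists (fun i => @iso_map i); split=> *; first exact: iso_map_bij.
  exact: iso_map_homog.
exact: iso_map_gdiff.
Qed.

End Dehomogenization.

Section Isomorphisms.
Variables (k : fieldType) (n : nat) (I : {mpoly k[n]} -> Prop).
Variables (F : gseq k n) (m : nat).
Notation R := {mpoly k[n]}.
Notation Hm := (homogenization k (@betti_incl_homo k n F m)).

Lemma gseq_iso_linear : gseq_iso Hm F -> betti_linear F m.
Proof.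
move=> [f [f_bij f_deg f_diff]].
pose b i (u : Hm i) := f i (gdelta k u).
have bE i (c : Hm i -> R) : \sum_u c u *: b i u = f i [ffun u => c u].
  rewrite [X in f i X]gdelta_sum linear_sum; apply: eq_bigr => u _.
  by rewrite linearZ ffunE.
exists (fun i => Hm i), b; split=> [i|i t c e s cs].
  split=> [t|v]; first exact/f_deg/gdelta_homog.
  have [g fK gK] := f_bij i; exists (g v); split=> [|c vc].
    by rewrite bE -{1}(gK v); congr (f i _); apply/ffunP => u; rewrite ffunE.
  rewrite vc bE fK; apply/ffunP => u; by rewrite ffunE.
exists (tag s), (tag t); split=> //; move: cs.
have [g fK _] := f_bij i.
have := can_inj fK; move/(_ _ _ (etrans (f_diff i _) (etrans e (bE i c)))).
move/ffunP/(_ s); rewrite !ffunE (bigD1 t) //= ffunE eqxx mul1r.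
rewrite big1 ?addr0 => [|u ut]; last by rewrite ffunE (negbTE ut) mul0r.
by rewrite /hmg_coef; case: ifP => // _ <-; rewrite eqxx.
Qed.

Lemma homogenization_minimal i w x : (gdiff Hm i w x : R)@_0%MM = 0.
Proof.
rewrite ffunE raddf_sum big1 //= => u _.
rewrite [LHS](rmorphM (mcoeff 0%MM)) /=.
suff -> : (hmg_coef u x : R)@_0%MM = 0 by rewrite mulr0.
rewrite /hmg_coef; case: ifP => [/andP[xu _]|_]; last exact: mcoeff0.
have nn : nneg (betti_incl (tag u) - betti_incl (tag x)).
  by rewrite zdeg_subr_ge0; apply: ltW.
set c := coord _ _ _; apply/eqP; apply: contraTT xu => c0.
have /eqP : betti_incl (tag u) - betti_incl (tag x) = 0.
  apply: mhomog_const c0; apply/mhomogZ/mhomog_zmon => j; exact: (nnegP _ nn).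
by rewrite subr_eq0 => /eqP/val_inj ->; rewrite ltxx.
Qed.

Lemma gseq_iso_resolution (G : gseq k n) : gseq_iso G F ->
  (forall i w (x : G i), (gdiff G i w x : R)@_0%MM = 0) ->
  minimal_resolution I F m -> minimal_resolution I G m.
Proof.
move=> [f [f_bij f_deg f_diff]] G_min F_res.
have f0 i v : f i v = 0 -> v = 0.
  by move=> e; apply: (bij_inj (f_bij i)); rewrite e linear0.
have im i v : (exists w, gdiff G i w = v) <-> exists w, gdiff F i w = f i v.
  split=> [[w <-]|[w wv]]; first by exists (f i.+1 w); rewrite f_diff.
  have [g _ gK] := f_bij i.+1; exists (g w).
  by apply: (bij_inj (f_bij i)); rewrite f_diff gK.
split=> //.
- move=> i /(mr_length F_res) Fi0; apply/eqP; rewrite -leqn0 leqNgt.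
  apply/negP => /card_gt0P[x _].
  have /f0/ffunP/(_ x) : f i (gdelta k x) = 0.
    by apply/ffunP => y; have := max_card (pred1 y); rewrite card1 Fi0.
  by rewrite !ffunE eqxx => /eqP; rewrite oner_eq0.
- have [eps [eps_deg eps_im eps_ker]] := mr_augmentation F_res.
  exists (eps \o f 0%N); split=> [g v hv|p|v].
  + exact/eps_deg/f_deg.
  + rewrite eps_im; split=> [[v <-]|[v <-]]; last by exists (f 0%N v).
    by have [g _ gK] := f_bij 0%N; exists (g v); rewrite /= gK.
  + by rewrite im; apply: eps_ker.
- move=> i v; rewrite im -(mr_exact F_res) -f_diff.
  by split=> [->|/f0//]; rewrite linear0.
Qed.

End Isomorphisms.

Section PureResolutions.
Variables (k : fieldType) (n : nat) (I : {mpoly k[n]} -> Prop).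
Variables (F : gseq k n) (m : nat) (F_res : minimal_resolution I F m).
Hypothesis F_pure : pure_resolution F.

Lemma total_deg_lt (z w : zdeg n) : (z < w)%O -> total_deg z < total_deg w.
Proof.
rewrite lt_neqAle => /andP[nzw /zdegP zw].
have [j zwj] : exists j, z j != w j.
  apply/existsP; apply: contraNT nzw; rewrite negb_exists => /forallP e.
  by apply/eqP/ffunP => j; apply/eqP; have := e j; rewrite negbK.
rewrite /total_deg (bigD1 j) //= [ltRHS](bigD1 j) //=; apply: ltr_leD.
  by rewrite lt_neqAle zwj zw.
by apply: ler_sum => i _; apply: zw.
Qed.

Lemma pure_total_deg i (x y : F i) : total_deg (gdeg x) = total_deg (gdeg y).
Proof. by have [d dP] := F_pure i; rewrite !dP. Qed.

Lemma pure_total_deg_lt i j (x : F i) (y : F j) : (i < j)%N ->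
  total_deg (gdeg x) < total_deg (gdeg y).
Proof.
elim: j y => // j IH y; rewrite ltnS leq_eqVlt.
have [z /(gdiff_gdelta_lt F_res)/total_deg_lt zy] := gdiff_gdelta_neq0 F_res y.
case/predU1P=> [ij|/(IH z) xz]; last exact: lt_trans xz zy.
by subst i; rewrite (pure_total_deg x z).
Qed.

Lemma gdelta_basis (X : gfree n) : homog_basis (fun x : X => gdelta k x).
Proof.
split=> [x|v]; first exact: gdelta_homog.
exists v; split=> [|c ->]; first exact: gdelta_sum.
by rewrite -gdelta_sum.
Qed.

Lemma pure_betti_linear : betti_linear F m.
Proof.
exists (fun i => F i), (fun i x => gdelta k x); split=> [i|i t c e s cs].
  exact: gdelta_basis.
exists (SeqSub (betti_degs_bound F_res s)), (SeqSub (betti_degs_bound F_res t)).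
split=> //.
have st : (gdeg s < gdeg t)%O.
  apply: (gdiff_gdelta_lt F_res); rewrite e sum_ffunE (bigD1 s) //= big1 => [|x xs].
    by rewrite !ffunE eqxx addr0 [_ *: _]mulr1.
  by rewrite !ffunE eq_sym (negbTE xs) scaler0.
apply/andP; split; first exact: st.
apply/forallP => z; apply/negP => /andP[sz zt].
have /flatten_mapP[j _ /imageP[x _ zx]] := valP z.
have sx : total_deg (gdeg s) < total_deg (gdeg x).
  by rewrite -zx; apply: total_deg_lt.
have xt : total_deg (gdeg x) < total_deg (gdeg t).
  by rewrite -zx; apply: total_deg_lt.
have [ij|] := ltnP i j.
  move: ij; rewrite leq_eqVlt => /predU1P[ij|/(pure_total_deg_lt t x) tx].
    by subst j; move: xt; rewrite (pure_total_deg x t) ltxx.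
  by have := lt_trans tx xt; rewrite ltxx.
rewrite leq_eqVlt => /predU1P[ij|/(pure_total_deg_lt x s) xs].
  by subst j; move: sx; rewrite (pure_total_deg x s) ltxx.
by have := lt_trans xs sx; rewrite ltxx.
Qed.

End PureResolutions.

Theorem theorem2p5 (k : fieldType) (n : nat) (I : {mpoly k[n]} -> Prop)
    (I_monomial : monomial_ideal I) (I_neq0 : exists2 p, I p & p != 0)
    (F : gseq k n) (m : nat) (F_res : minimal_resolution I F m) :
  (betti_linear F m <->
     gseq_iso (homogenization k (@betti_incl_homo k n F m)) F) /\
  (pure_resolution F ->
     exists m', minimal_resolution I
       (homogenization k (@betti_incl_homo k n F m)) m').
Proof.
have linear_iso : betti_linear F m ->
    gseq_iso (homogenization k (@betti_incl_homo k n F m)) F.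
  move=> [T [b [b_basis b_linear]]].
  have [eps [eps_homog _ eps_ker]] := mr_augmentation F_res.
  exact: (linear_gseq_iso F_res eps_homog eps_ker b_basis b_linear).
split; first by split=> //; apply: gseq_iso_linear.
move=> F_pure; exists m; apply: (gseq_iso_resolution _ _ F_res).
  exact/linear_iso/(pure_betti_linear F_res F_pure).
exact: homogenization_minimal.
Qed.
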